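(* Let $n\in\mathbb{N}$ and let $\phi\in\mathcal{S}(\mathbb{R}^{2n})$ be a Schwartz function with inverse Fourier transform $\check{\phi}\in\mathcal{S}(\mathbb{R}^{2n})$. Then the integral $$I_2(\phi)=\iint_{\langle\omega,\nu\rangle=0}\mathrm{P.V.}\int_0^\infty\int_0^\infty\frac{r^{n-1}\rho^{n-1}}{-r^2+\rho^2}\,\check{\phi}(r\omega,\rho\nu)\,dr\,d\rho\,d\omega\,d\nu$$ exists, where the symbol on the right-hand side is defined as the limit $$I_2(\phi)=\lim_{\epsilon\to0}\iint_{\{(\omega,\nu)\in S^{n-1}\times S^{n-1}:\,|\langle\omega,\nu\rangle|\ge\epsilon\}}\left[\mathrm{P.V.}\int_0^\infty\int_0^\infty\frac{r^{n-1}\rho^{n-1}}{-r^2+\rho^2}\,\check{\phi}(r\omega,\rho\nu)\,dr\,d\rho\right]d\omega\,d\nu .$$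
   Context: $S^{n-1}$ is the unit sphere of $\mathbb{R}^n$ and $d\omega$, $d\nu$ denote its surface measure; $\langle\cdot,\cdot\rangle$ is the Euclidean inner product on $\mathbb{R}^n$; points of $\mathbb{R}^{2n}$ are written $(\xi,\eta)\in\mathbb{R}^n\times\mathbb{R}^n$. The inverse Fourier transform is $\check{\phi}(\xi,\eta)=\frac{1}{(2\pi)^{2n}}\int_{\mathbb{R}^{2n}}e^{i(\langle x,\xi\rangle+\langle y,\eta\rangle)}\phi(x,y)\,dx\,dy$. The principal value of a function $f$ on $(0,\infty)^2$ is defined by $$\mathrm{P.V.}\int_0^\infty\int_0^\infty f(r,\rho)\,dr\,d\rho:=\lim_{a\to\infty}\int_{1/a}^{a}\int_{\frac1a\le|\frac{\pi}{4}-\theta|\le\frac{\pi}{4}}f(R\cos\theta,R\sin\theta)\,R\,d\theta\,dR .$$ *)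

(* Defs.v *)
From HB Require Import structures.
From mathcomp Require Import all_boot all_order all_algebra.
From mathcomp Require Import all_classical all_reals all_analysis.
From mathcomp Require Import measurable_realfun complex.

Set Implicit Arguments.
Unset Strict Implicit.
Unset Printing Implicit Defensive.

Import Order.TTheory GRing.Theory Num.Theory numFieldNormedType.Exports.

Local Open Scope classical_set_scope.
Local Open Scope ring_scope.

(* R[i] under a numFieldType, so that its canonical (modulus) topology is
   available for limits. *)
Definition Cplx (R : realType) : numClosedFieldType := R[i]%C.

Definition dotv (R : pzRingType) (n : nat) (x y : 'rV[R]_n) : R :=
  \sum_(i < n) x 0 i * y 0 i.

Definition enorm (R : realType) (n : nat) (x : 'rV[R]_n) : R :=
  Num.sqrt (dotv x x).

Definition sphere (R : realType) (n : nat) : set 'rV[R]_n :=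
  [set x | enorm x = 1].
Arguments sphere R n : clear implicits.

(* ['rV[T]_n] carries the product sigma-algebra, like [n.-tuple T]. *)
Definition measure_rV_display : measure_display -> measure_display.
Proof. exact. Qed.

Section measurable_rV.
Context {d} {T : sigmaRingType d}.
Variable n : nat.

Let coors : 'I_n -> 'rV[T]_n -> T := fun i x => x 0 i.

Let rV_set0 : g_sigma_preimage coors set0.
Proof. exact: sigma_algebra0. Qed.

Let rV_setC A : g_sigma_preimage coors A -> g_sigma_preimage coors (~` A).
Proof. exact: sigma_algebraC. Qed.

Let rV_bigcup (F : _^nat) : (forall i, g_sigma_preimage coors (F i)) ->
  g_sigma_preimage coors (\bigcup_i (F i)).
Proof. exact: sigma_algebra_bigcup. Qed.

HB.instance Definition _ := @isMeasurable.Build (measure_rV_display d)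
  'rV[T]_n (g_sigma_preimage coors) rV_set0 rV_setC rV_bigcup.

End measurable_rV.


Lemma measurable_coord d (T : measurableType d) n (i : 'I_n) :
  measurable_fun [set: 'rV[T]_n] (fun x => x 0 i).
Proof.
move=> _ Y mY; rewrite setTI; apply: sub_sigma_algebra => /=.
rewrite -bigcup_seq/=; exists i => /=; first by rewrite mem_index_enum.
by exists Y => //; rewrite setTI.
Qed.

Lemma measurable_fun_rV d1 d2 (T1 : measurableType d1) (T2 : measurableType d2)
    n (f : T1 -> 'rV[T2]_n) :
  (forall i, measurable_fun [set: T1] (fun x => f x 0 i)) ->
  measurable_fun [set: T1] f.
Proof.
move=> mf; apply: (@measurability _ _ T1 'rV[T2]_n setT f
  (\big[setU/set0]_(i < n)
     preimage_set_system setT (fun x : 'rV[T2]_n => x 0 i) measurable)) => //.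
move=> _ [B + <-]; rewrite -bigcup_seq/= => -[i _ [A mA <-]].
rewrite setTI; exact: (mf i measurableT A mA).
Qed.

Section lebesgue_rV.
Context (R : realType).

(* R * R^n -> R^(n+1) and its inverse *)
Definition rV_cons n (p : measurableTypeR R * 'rV[R]_n) : 'rV[R]_n.+1 :=
  \row_i oapp (p.2 0) p.1 (unlift ord0 i).

Definition rV_uncons n (x : 'rV[R]_n.+1) : measurableTypeR R * 'rV[R]_n :=
  (x 0 ord0, \row_i x 0 (lift ord0 i)).

Lemma rV_consE0 n (p : measurableTypeR R * 'rV[R]_n) : rV_cons p 0 ord0 = p.1.
Proof. by rewrite mxE unlift_none. Qed.

Lemma rV_consES n (p : measurableTypeR R * 'rV[R]_n) (i : 'I_n) :
  rV_cons p 0 (lift ord0 i) = p.2 0 i.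
Proof. by rewrite mxE liftK. Qed.

Lemma rV_consK n : cancel (@rV_cons n) (@rV_uncons n).
Proof.
case=> x y; rewrite /rV_uncons rV_consE0; congr pair.
by apply/rowP => i; rewrite mxE rV_consES.
Qed.

Lemma measurable_rV_cons n : measurable_fun setT (@rV_cons n).
Proof.
apply: measurable_fun_rV => i; case: (unliftP ord0 i) => [j|] ->.
  under eq_fun do rewrite rV_consES.
  exact: (measurableT_comp (measurable_coord j) measurable_snd).
under eq_fun do rewrite rV_consE0.
exact: measurable_fst.
Qed.

Lemma measurable_rV_uncons n : measurable_fun setT (@rV_uncons n).
Proof.
apply/measurable_fun_pairP; split; first exact: (measurable_coord ord0).
apply: measurable_fun_rV => i /=.
under eq_fun do rewrite mxE.
exact: measurable_coord.
Qed.

Section step.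
Context n (leb : {sigma_finite_measure set (measurableTypeR R) -> \bar R})
  (mu : {sigma_finite_measure set 'rV[R]_n -> \bar R}).

Definition lebesgue_rV_step : set 'rV[R]_n.+1 -> \bar R :=
  pushforward (leb \x mu)%E (@rV_cons n).

HB.instance Definition _ := Measure.copy lebesgue_rV_step
  (measure_function_pushforward__canonical__measure_function_Measure
     (leb \x mu)%E (@measurable_rV_cons n)).

Let step_sigma_finite : sigma_finite setT lebesgue_rV_step.
Proof.
have /sigma_finiteP[F [TF ndF Foo]] := sigma_finiteT leb.
have /sigma_finiteP[G [TG ndG Goo]] := sigma_finiteT mu.
exists (fun k => @rV_uncons n @^-1` (F k `*` G k)).
  rewrite -preimage_bigcup -[LHS](preimage_setT (@rV_uncons n)); congr preimage.
  rewrite -setXTT TF TG predeqE => -[x y]; split.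
    move=> [/= [j _ Fjx] [k _ Gky]]; exists (maxn j k) => //; split.
    - by move: x Fjx; exact/subsetPset/ndF/leq_maxl.
    - by move: y Gky; exact/subsetPset/ndG/leq_maxr.
  by move=> [k _ []/= ? ?]; split; exists k.
move=> k; have [? ?] := Foo k; have [? ?] := Goo k; split.
  rewrite -[X in measurable X]setTI; apply: measurable_rV_uncons => //.
  exact: measurableX.
rewrite /lebesgue_rV_step /pushforward -comp_preimage.
rewrite (_ : _ \o _ = id); last by apply/funext => p /=; rewrite rV_consK.
by rewrite preimage_id product_measure1E// lte_mul_pinfty// ge0_fin_numE.
Qed.

HB.instance Definition _ := Measure_isSigmaFinite.Build _ _ _
  lebesgue_rV_step step_sigma_finite.

End step.

Fixpoint lebesgue_rV n : {sigma_finite_measure set 'rV[R]_n -> \bar R} :=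
  match n with
  | 0 => \d_(0 : 'rV[R]_0)
  | n'.+1 => lebesgue_rV_step lebesgue_measure (lebesgue_rV n')
  end.

End lebesgue_rV.

Section surface_measure.
Context (R : realType).

Definition punctured_ball n : set 'rV[R]_n := [set x | 0 < enorm x <= 1].

Definition normalize n (x : 'rV[R]_n) : 'rV[R]_n := (enorm x)^-1 *: x.

Lemma measurable_enorm n : measurable_fun setT (@enorm R n).
Proof.
apply: (measurableT_comp (f := @Num.sqrt R)).
  exact: (continuous_measurable_fun (@sqrt_continuous R)).
by apply: measurable_sum => i; apply: measurable_funM; exact: measurable_coord.
Qed.

Lemma measurable_normalize n : measurable_fun setT (@normalize n).
Proof.
apply: measurable_fun_rV => i.
rewrite (_ : (fun _ => _) = fun x : 'rV[R]_n => (enorm x) `^ (-1) * x 0 i).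
  apply: measurable_funM; last exact: measurable_coord.
  exact: (measurableT_comp (measurable_powR (-1)) (@measurable_enorm n)).
by apply/funext => x; rewrite mxE powR_inv1// sqrtr_ge0.
Qed.

Lemma measurable_punctured_ball n : measurable (@punctured_ball n).
Proof.
rewrite (_ : @punctured_ball n = @enorm R n @^-1` `]0, 1]%classic).
  by rewrite -[X in measurable X]setTI; exact: measurable_enorm.
by apply/seteqP; split => x /=; rewrite in_itv.
Qed.

Let cube n : set 'rV[R]_n := [set x | forall i, `|x 0 i| <= 1].

Let cubeP n : measurable (@cube n) /\ (lebesgue_rV R n (@cube n) < +oo)%E.
Proof.
elim: n => [|n [mc fc]].
  rewrite (_ : @cube 0 = setT); last by apply/seteqP; split => // x _ [].
  by split => //=; rewrite diracT ltry.
have cE : @rV_cons R n @^-1` @cube n.+1 = `[-1, 1]%classic `*` @cube n.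
  apply/seteqP; split => -[x y] /=.
    move=> cxy; split => [|i].
      by have := cxy ord0; rewrite rV_consE0 in_itv /= ler_norml.
    by have := cxy (lift ord0 i); rewrite rV_consES.
  rewrite in_itv /= -ler_norml => -[x1 cy] i.
  case: (unliftP ord0 i) => [j|] ->; first by rewrite rV_consES.
  by rewrite rV_consE0.
split.
  rewrite (_ : @cube n.+1 = @rV_uncons R n @^-1` (`[-1, 1]%classic `*` @cube n)).
    rewrite -[X in measurable X]setTI; apply: measurable_rV_uncons => //.
    exact: measurableX.
  rewrite -cE -comp_preimage; apply/seteqP; split => x /=;
    (suff -> : rV_cons (rV_uncons x) = x by []);
    apply/rowP => i; case: (unliftP ord0 i) => [j|] ->;
    by rewrite ?rV_consES ?rV_consE0 ?mxE.
rewrite /= /lebesgue_rV_step /pushforward cE product_measure1E//.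
have f1 : (lebesgue_measure (`[(-1)%R, 1%R]%classic : set R) < +oo)%E.
  by rewrite lebesgue_measure_itv/=; case: ifP => // _; rewrite ltry.
apply: lte_mul_pinfty => //; rewrite ge0_fin_numE//.
Qed.

Lemma punctured_ball_lty n : (lebesgue_rV R n (@punctured_ball n) < +oo)%E.
Proof.
have [mc fc] := cubeP n; apply: le_lt_trans fc.
apply: le_measure; rewrite ?inE//; first exact: measurable_punctured_ball.
move=> x /= /andP[_ x1] i.
rewrite -(@ler_pXn2r _ 2)// ?nnegrE// expr1n real_normK ?num_real//.
rewrite (@le_trans _ _ (dotv x x))//.
  rewrite /dotv (bigD1 i)//= expr2 lerDl sumr_ge0// => j _.
  by rewrite -expr2 sqr_ge0.
have dx : 0 <= dotv x x by apply: sumr_ge0 => j _; rewrite -expr2 sqr_ge0.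
by rewrite -(sqr_sqrtr dx) -/(enorm x) exprn_ile1// sqrtr_ge0.
Qed.

(* sigma(A) = n * |{x | 0 < |x| <= 1, x / |x| \in A}|, the measure for which
   dx = r^(n-1) dr dsigma; a measure on the ambient space concentrated on
   the sphere. *)
Definition surface_measure n (A : set 'rV[R]_n) : \bar R :=
  (n%:R%:E * lebesgue_rV R n (@normalize n @^-1` A `&` @punctured_ball n))%E.

HB.instance Definition _ n := Measure.copy (@surface_measure n)
  (mscale (n%:R%:nng : {nonneg R})
    (measure_function_pushforward__canonical__measure_function_Measure
     (mrestr (lebesgue_rV R n) (@measurable_punctured_ball n))
     (@measurable_normalize n))).

Let surface_measure_fin n : fin_num_fun (@surface_measure n).
Proof.
move=> A mA; rewrite /surface_measure fin_numM// ge0_fin_numE//.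
apply: le_lt_trans (punctured_ball_lty n); apply: le_measure; rewrite ?inE//.
- apply: measurableI; last exact: measurable_punctured_ball.
  by rewrite -[X in measurable X]setTI; exact: measurable_normalize.
- exact: measurable_punctured_ball.
Qed.

HB.instance Definition _ n := Measure_isFinite.Build _ _ _
  (@surface_measure n) (@surface_measure_fin n).

End surface_measure.
Arguments surface_measure R n : clear implicits.

Section complex_integral.
Context d (T : measurableType d) (R : realType).
Variables (mu : {measure set T -> \bar R}) (D : set T) (f : T -> Cplx R).

Definition Cintegrable : Prop :=
  mu.-integrable D (fun x => (complex.Re (f x))%:E) /\
  mu.-integrable D (fun x => (complex.Im (f x))%:E).

Definition Cintegral : Cplx R :=
  ((\int[mu]_(x in D) complex.Re (f x)) +i*
   (\int[mu]_(x in D) complex.Im (f x)))%C.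

End complex_integral.

Section schwartz.
Context (R : realType) (m : nat).
Implicit Types (f : 'rV[R]_m -> R) (s : seq 'I_m).

(* the partial derivatives along the indices listed in s, iterated *)
Definition pderivs s f : 'rV[R]_m -> R :=
  foldr (fun i g => fun x => 'D_(delta_mx 0 i) g x) f s.

Definition smooth f : Prop := forall s, continuous (pderivs s f) /\
  forall x i, derivable (pderivs s f) x (delta_mx 0 i).

Definition schwartz_real f : Prop := smooth f /\
  forall (alpha : 'I_m -> nat) s, exists M : R,
    forall x : 'rV[R]_m,
      `|(\prod_(i < m) x 0 i ^+ alpha i) * pderivs s f x| <= M.

Definition schwartz (phi : 'rV[R]_m -> Cplx R) : Prop :=
  schwartz_real (fun x => complex.Re (phi x)) /\
  schwartz_real (fun x => complex.Im (phi x)).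

Definition inverse_fourier (phi : 'rV[R]_m -> Cplx R) (zeta : 'rV[R]_m) :
    Cplx R :=
  (((2 * pi) ^- m)%:C *
   Cintegral (lebesgue_rV R m) setT
     (fun z => (cos (dotv z zeta) +i* sin (dotv z zeta)) * phi z))%C.

End schwartz.

Section principal_value.
Context (R : realType).
Variable f : R -> R -> Cplx R.

Definition pv_sector (a : R) : set R :=
  [set theta | a^-1 <= `|pi / 4 - theta| <= pi / 4].

Definition pv_polar (r theta : R) : Cplx R :=
  (f (r * cos theta) (r * sin theta) * r%:C)%C.

Definition pv_truncated (a : R) : Cplx R :=
  Cintegral (@lebesgue_measure R) `[a^-1, a]%classic (fun r =>
    Cintegral (@lebesgue_measure R) (pv_sector a) (pv_polar r)).

(* [Rintegral] is total, so the existence of the truncated integrals is a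
   separate requirement. *)
Definition pv_truncated_integrable (a : R) : Prop :=
  (forall r : R, r \in `[a^-1, a] ->
     Cintegrable (@lebesgue_measure R) (pv_sector a) (pv_polar r)) /\
  Cintegrable (@lebesgue_measure R) `[a^-1, a]%classic (fun r =>
    Cintegral (@lebesgue_measure R) (pv_sector a) (pv_polar r)).

Definition pv_exists : Prop :=
  (\forall a \near +oo, pv_truncated_integrable a) /\
  cvg (pv_truncated a @[a --> +oo]).

Definition pv : Cplx R := lim (pv_truncated a @[a --> +oo]).

End principal_value.

Section I2.
Context (R : realType) (n : nat).
Variable phi : 'rV[R]_(n + n) -> Cplx R.

Definition I2_integrand (omega nu : 'rV[R]_n) (r rho : R) : Cplx R :=
  ((r ^+ n.-1 * rho ^+ n.-1 / (- r ^+ 2 + rho ^+ 2))%:C *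
   inverse_fourier phi (row_mx (r *: omega) (rho *: nu)))%C.

Definition I2_region (eps : R) : set ('rV[R]_n * 'rV[R]_n) :=
  [set p | [/\ sphere R n p.1, sphere R n p.2 & eps <= `|dotv p.1 p.2|]].

Definition I2_truncated (eps : R) : Cplx R :=
  Cintegral (surface_measure R n \x surface_measure R n)%E (I2_region eps)
    (fun p => pv (I2_integrand p.1 p.2)).

End I2.

(* Main.v *)
(* The principal value P(omega, nu) turns out to be bounded on S^(n-1) x S^(n-1),
   including near <omega, nu> = 0, so the limit in eps is plain dominated
   convergence over a space of finite measure.

   For the bound, fold the angular integral with theta -> pi/2 - theta: the two
   singular halves combine into a difference F(z) - F(z') of the inverse Fourier
   transform F at z = (r sin t omega, r cos t nu), z' = (r cos t omega, r sin t nu),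
   times r^(2n-2) / (r (cos t - sin t)) and a bounded factor.  Since |z| = |z'| = r and
   |z|^2 F = -(Laplacian phi)^, the Lipschitz bound for transforms of Schwartz
   functions self-improves by induction to
   r^(2k) |F(z) - F(z')| <= C_k |z - z'|, with |z - z'| = O(r (cos t - sin t)).
   Taking k = n - 1 and k = n bounds the folded integrand by K / (1 + r^2). *)
Require Import Defs.
From mathcomp Require Import all_boot all_order all_algebra.
From mathcomp Require Import all_classical all_reals all_analysis.
From mathcomp Require Import measurable_realfun complex.
From mathcomp Require Import ring lra.

Set Implicit Arguments.
Unset Strict Implicit.
Unset Printing Implicit Defensive.

Import Order.TTheory GRing.Theory Num.Theory numFieldNormedType.Exports.

Local Open Scope classical_set_scope.
Local Open Scope ring_scope.

(** * Measurability and dominated convergence *)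

(** The fold is legitimate only before the limit: on a truncated sector both halves of the kernel
    are bounded and may be integrated separately, while in the limit in general only their sum is
    integrable. After folding, a truncation survives merely as an indicator on a fixed domain, so
    the angular cut, the radial cut and the cut in eps all disappear by dominated convergence.

    The estimate concerns differences of F and not its gradient. For two points of equal norm the
    factor |z|^2 passes through the difference without a correction term, so each gain of |z|^2
    costs two derivatives of the Schwartz function and F itself is never differentiated. The
    distance O(r (cos t - sin t)) pays for both zeros of the denominator: the diagonal and the
    origin. The remaining factor 1 / (cos t + sin t) is at most 1 on the octant.

    All estimates are real: the real and imaginary parts of F are combinations of cosine integrals
    with a phase. Majorants on row vectors are products of 1 / (1 + x_i^2), which fit the recursive
    definition of Lebesgue measure there. *)

Lemma open_measurable_rV (R : realType) n (U : set 'rV[R]_n) :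
  open U -> measurable (U : set 'rV[measurableTypeR R]_n).
Proof.
move=> oU.
pose c (q : 'rV[rat]_n) : 'rV[R]_n := map_mx ratr q.
(* Cubes with rational centre and radius 1 / (k+1): there are countably many, each lies in the
   product sigma-algebra, and those inside [U] cover [U]. *)
pose B (p : 'rV[rat]_n * nat) : set 'rV[R]_n :=
  \bigcap_(i in [set: 'I_n])
    ((fun x : 'rV[R]_n => x 0 i) @^-1` ball (c p.1 0 i) p.2.+1%:R^-1).
have mB p : measurable (B p : set 'rV[measurableTypeR R]_n).
  apply: fin_bigcap_measurable => // i _.
  rewrite -[X in measurable X]setTI.
  exact: (@measurable_coord _ (measurableTypeR R) n i measurableT _
    (measurable_ball _ _)).
rewrite (_ : U = \bigcup_(p in [set p | B p `<=` U]) B p).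
  rewrite bigcup_mkcond; apply: countable_bigcupT_measurable => [|p].
    exact: countableP.
  by case: ifP.
apply/seteqP; split=> [x Ux|x [p pU Bx]]; last exact: pU.
have /nbhs_ballP[e /= e0 xeU] : nbhs x U by exact: open_nbhs_nbhs.
have /ltr_add_invr[k] : 0 < e / 2 by rewrite divr_gt0.
rewrite add0r => ke.
have d0 : 0 < k.+1%:R^-1 :> R by rewrite invr_gt0.
have qP i : exists q : rat, ball (ratr q : R) k.+1%:R^-1 (x 0 i).
  have /rat_in_itvoo[q] : x 0 i - k.+1%:R^-1 < x 0 i + k.+1%:R^-1.
    by rewrite ltrBlDr -addrA ltrDl addr_gt0.
  rewrite in_itv /= => /andP[q1 q2]; exists q.
  by rewrite -ball_normE /= ltr_norml; move: q1 q2; move: k.+1%:R^-1 => d; lra.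
pose q : 'rV[rat]_n := \row_i projT1 (cid (qP i)).
have qx i : ball (c q 0 i) k.+1%:R^-1 (x 0 i).
  by rewrite /c !mxE; exact: projT2 (cid (qP i)).
exists (q, k); last by move=> i _ /=; exact: qx.
move=> y /= By; apply: xeU; split => // i j; rewrite ord1.
have := ball_triangle (ball_sym (qx j)) (By j I).
by apply: le_ball; rewrite (splitr e) lerD// ltW.
Qed.

Lemma continuous_measurable_fun_rV (R : realType) n (f : 'rV[R]_n -> R) :
  continuous f ->
  measurable_fun [set: 'rV[measurableTypeR R]_n] (f : _ -> measurableTypeR R).
Proof.
move=> /continuousP cf; apply: (measurability _ (RGenOpens.measurableE R)).
move=> _ [_ [a [b ->] <-]]; rewrite setTI; apply: open_measurable_rV.
exact/cf/interval_open.
Qed.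

(** [powR] with exponent -1 is measurable but is matched with the inverse only on nonnegative
    numbers, hence the detour through the square; at 0 both sides are 0 by convention. *)
Lemma measurable_invr (R : realType) :
  measurable_fun [set: R] (fun x : R => x^-1).
Proof.
rewrite (_ : (fun x : R => x^-1) = fun x : R => x * (x ^+ 2) `^ (-1)).
  apply: measurable_funM => //.
  by apply: (measurableT_comp (measurable_powR (-1))); exact: measurable_funX.
apply/funext => x; rewrite powR_inv1 ?sqr_ge0//.
have [->|x0] := eqVneq x 0; first by rewrite invr0 mul0r.
by rewrite expr2 invfM mulrA divff// mul1r.
Qed.

Lemma measurable_funVr d (T : measurableType d) (R : realType) (D : set T)
    (f : T -> R) :
  measurable_fun D f -> measurable_fun D (fun x => (f x)^-1).
Proof. exact: measurableT_comp (@measurable_invr R). Qed.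

(** Tonelli applies to the positive and negative parts separately, and [fine] brings their
    difference back to the reals. The indicator of [D] moves into the integrand so that both
    integrals run over the whole space. *)
Lemma measurable_fun_Rintegral d1 d2 (T1 : measurableType d1)
    (T2 : measurableType d2) (R : realType)
    (mu : {sigma_finite_measure set T2 -> \bar R}) (D : set T2)
    (f : T1 * T2 -> R) :
  measurable D -> measurable_fun setT f ->
  measurable_fun setT (fun x => \int[mu]_(y in D) f (x, y)).
Proof.
move=> mD mf.
pose g (p : T1 * T2) := (f p * \1_D p.2)%:E.
have mg : measurable_fun setT g.
  apply/measurable_EFinP; apply: measurable_funM => //.
  by apply: (measurableT_comp (measurable_indic mD)); exact: measurable_snd.
apply: (@measurableT_comp _ _ _ _ _ _ fine) => //.
rewrite (_ : (fun x : T1 => _) = fun x =>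
    (\int[mu]_y (g^\+ (x, y)) - \int[mu]_y (g^\- (x, y)))%E).
  apply: emeasurable_funB.
    apply: (@measurable_fun_fubini_tonelli_F _ _ _ _ _ mu) => //.
    exact: measurable_funepos.
  apply: (@measurable_fun_fubini_tonelli_F _ _ _ _ _ mu) => //.
  exact: measurable_funeneg.
apply/funext => x; rewrite integral_mkcond integralE.
by congr (_ - _)%E; apply: eq_integral => y _; rewrite ?funeposE ?funenegE;
  rewrite /g patchE indicE /=; case: (y \in D); rewrite ?mulr1 ?mulr0.
Qed.

Section dominated_convergence_filters.
Context d (T : measurableType d) (R : realType).
Variables (mu : {measure set T -> \bar R}) (D : set T) (g h : T -> R).
Hypotheses (mD : measurable D) (mg : measurable_fun D g).
Hypothesis ih : mu.-integrable D (EFin \o h).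

Lemma dominated_cvg_Rintegral (f : nat -> T -> R) :
  (forall k, measurable_fun D (f k)) ->
  (forall k x, D x -> `|f k x| <= h x) ->
  (forall x, D x -> f k x @[k --> \oo] --> g x) ->
  \int[mu]_(x in D) f k x @[k --> \oo] --> \int[mu]_(x in D) g x.
Proof.
move=> mf fh fg.
have [|||||ig _ l] := @dominated_convergence d T R mu D mD
    (fun n x => (f n x)%:E) (EFin \o g) (EFin \o h).
- by move=> n; exact/measurable_EFinP.
- exact/measurable_EFinP.
- by apply: aeW => x Dx; apply: cvg_EFin; [exact: nearW|exact: fg].
- exact: ih.
- by apply: aeW => x n Dx; rewrite lee_fin fh.
by apply: fine_cvg; rewrite fineK// integrable_fin_num.
Qed.

Variable f : R -> T -> R.
Hypothesis mf : forall a, measurable_fun D (f a).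
Hypothesis fh : forall a x, D x -> `|f a x| <= h x.

(** Limits at [+oo], and below at [p^'+], can be tested along sequences, which reduces both filters
    to the sequential theorem. *)
Lemma dominated_cvg_pinfty :
  (forall x, D x -> f a x @[a --> +oo] --> g x) ->
  \int[mu]_(x in D) f a x @[a --> +oo] --> \int[mu]_(x in D) g x.
Proof.
move=> fg; apply/cvg_pinftyP => u uoo.
apply: (dominated_cvg_Rintegral (f := fun k => f (u k))) => [//|k x|x Dx].
  exact: fh.
by move/cvg_pinftyP: (fg x Dx); apply.
Qed.

Lemma dominated_cvg_at_right (p : R) :
  (forall x, D x -> f a x @[a --> p^'+] --> g x) ->
  \int[mu]_(x in D) f a x @[a --> p^'+] --> \int[mu]_(x in D) g x.
Proof.
move=> fg; apply/cvg_at_rightP => u up.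
apply: (dominated_cvg_Rintegral (f := fun k => f (u k))) => [//|k x|x Dx].
  exact: fh.
by move/cvg_at_rightP: (fg x Dx); apply.
Qed.

End dominated_convergence_filters.

Lemma cvg_Cplx (R : realType) (T : Type) (F : set_system T) (FF : Filter F)
    (f : T -> Cplx R) (a b : R) :
  (complex.Re (f x) @[x --> F] --> a) -> (complex.Im (f x) @[x --> F] --> b) ->
  f x @[x --> F] --> ((a +i* b)%C : Cplx R).
Proof.
move=> fa fb; apply/cvgrPdist_lt => /= e.
(* In the order of [Cplx R], a positive [e] has zero imaginary part, so it is the real number
   [e']. *)
rewrite ltcE /= => /andP[/eqP]; case: e => e' i /= -> e0.
move/cvgrPdist_lt: fa => /(_ (e' / 2)); rewrite divr_gt0// => /(_ isT) fa.
move/cvgrPdist_lt: fb => /(_ (e' / 2)); rewrite divr_gt0// => /(_ isT) fb.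
near=> x.
have xa : `|a - complex.Re (f x)| < e' / 2 by near: x; exact: fa.
have xb : `|b - complex.Im (f x)| < e' / 2 by near: x; exact: fb.
move: xa xb; case: (f x) => u v /= xa xb.
rewrite normc_def /= ltcR.
have A := normr_ge0 (a - u); have B := normr_ge0 (b - v).
rewrite -(ger0_norm (ltW e0)) -sqrtr_sqr ltr_sqrt ?exprn_gt0//.
rewrite -[X in X + _](real_normK (num_real _)).
rewrite -[X in _ + X](real_normK (num_real _)).
by nra.
Unshelve. all: by end_near.
Qed.

(** * Integration over row vectors *)

Section rV_integral.
Context (R : realType).
Notation leb := (@lebesgue_measure R).
Local Open Scope ereal_scope.

Lemma ge0_integral_rVS n (f : 'rV[R]_n.+1 -> \bar R) :
  measurable_fun setT f -> (forall z, 0 <= f z) ->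
  \int[lebesgue_rV R n.+1]_z f z =
  \int[leb]_x \int[lebesgue_rV R n]_y f (rV_cons (x, y)).
Proof.
move=> mf f0.
transitivity (\int[leb \x lebesgue_rV R n]_p f (rV_cons p)).
  exact: (ge0_integral_pushforward (@measurable_rV_cons R n)
    (leb \x lebesgue_rV R n) measurableT mf).
apply: (@fubini_tonelli1 _ _ _ _ _ _ _ (f \o @rV_cons R n)) => [|p]; last exact: f0.
exact: measurableT_comp mf (@measurable_rV_cons R n).
Qed.

Lemma integrable_rV_cons n (f : 'rV[R]_n.+1 -> \bar R) :
  (lebesgue_rV R n.+1).-integrable setT f ->
  (leb \x lebesgue_rV R n).-integrable setT (f \o @rV_cons R n).
Proof.
move=> /integrableP[mf foo].
apply/integrable12ltyP; first exact: measurableT_comp mf (@measurable_rV_cons R n).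
rewrite ge0_integral_rVS// in foo.
exact: measurableT_comp.
Qed.

Lemma integral_rV_cons n (f : 'rV[R]_n.+1 -> \bar R) :
  (lebesgue_rV R n.+1).-integrable setT f ->
  \int[lebesgue_rV R n.+1]_z f z = \int[leb \x lebesgue_rV R n]_p f (rV_cons p).
Proof.
move=> fi; have /integrableP[mf _] := fi.
exact: (integral_pushforward (@measurable_rV_cons R n) mf
  (integrable_rV_cons fi) measurableT).
Qed.

Lemma integral_rVS n (f : 'rV[R]_n.+1 -> \bar R) :
  (lebesgue_rV R n.+1).-integrable setT f ->
  \int[lebesgue_rV R n.+1]_z f z =
  \int[leb]_x \int[lebesgue_rV R n]_y f (rV_cons (x, y)).
Proof.
move=> fi; rewrite integral_rV_cons//.
by rewrite -(integral12_prod_meas1 (integrable_rV_cons fi)).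
Qed.

(** The head coordinate is innermost here, as needed in [integral_line_eq0] when the line runs along
    it. *)
Lemma integral_rVS_swap n (f : 'rV[R]_n.+1 -> \bar R) :
  (lebesgue_rV R n.+1).-integrable setT f ->
  \int[lebesgue_rV R n.+1]_z f z =
  \int[lebesgue_rV R n]_y \int[leb]_x f (rV_cons (x, y)).
Proof.
move=> fi; rewrite integral_rV_cons//.
by rewrite -(integral21_prod_meas1 (integrable_rV_cons fi)).
Qed.

End rV_integral.

Section weight.
Context (R : realType).
Notation leb := (@lebesgue_measure R).

Lemma oneDsqr_gt0 (x : R) : 0 < oneDsqr x.
Proof. exact: lt_le_trans ltr01 (oneDsqr_ge1 x). Qed.

Lemma oneDsqr_ge0 (x : R) : 0 <= oneDsqr x.
Proof. exact/ltW/oneDsqr_gt0. Qed.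

Lemma integrable_oneDsqrV :
  leb.-integrable setT (fun x : R => ((oneDsqr x)^-1)%:E).
Proof.
have c := @continuous_oneDsqrV R.
have m : measurable_fun setT (fun x : R => ((oneDsqr x)^-1)%:E).
  by apply/measurable_EFinP; exact: continuous_measurable_fun.
apply/integrableP; split; first exact: m.
under eq_integral do rewrite gee0_abs ?lee_fin ?invr_ge0 ?oneDsqr_ge0//.
rewrite (@ge0_symfun_integralT R (fun x => (oneDsqr x)^-1))//.
- rewrite (_ : [set x | (0 <= x)%R] = `[0, +oo[%classic).
    by rewrite integral0y_oneDsqr ltry.
  by apply/seteqP; split => x /=; rewrite in_itv/= andbT.
- by move=> x; rewrite /= /oneDsqr sqrrN.
Qed.

(** The common majorant of Schwartz functions. Its product form makes it integrable by Tonelli, one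
    coordinate at a time, and leaves a majorant of the same kind on every slice. *)
Definition weight n (z : 'rV[R]_n) : R := \prod_(i < n) (oneDsqr (z 0 i))^-1.

Lemma weight_gt0 n (z : 'rV[R]_n) : 0 < weight z.
Proof. by apply: prodr_gt0 => i _; rewrite invr_gt0 oneDsqr_gt0. Qed.

Lemma weight_cons n x (y : 'rV[R]_n) :
  weight (rV_cons (x, y)) = (oneDsqr x)^-1 * weight y.
Proof.
rewrite /weight big_ord_recl rV_consE0; congr (_ * _).
by apply: eq_bigr => i _; rewrite rV_consES.
Qed.

Lemma weight_le n (z : 'rV[R]_n) i : weight z <= (oneDsqr (z 0 i))^-1.
Proof.
rewrite /weight (bigD1 i)//= ler_piMr ?invr_ge0 ?oneDsqr_ge0//.
rewrite prodr_ile1// => j _; rewrite invr_ge0 oneDsqr_ge0 /=.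
exact: oneDsqrV_le1.
Qed.

Lemma measurable_weight n : measurable_fun setT (@weight n).
Proof.
apply: measurable_prod => i _; apply: measurable_funVr.
apply: measurable_funD => //; apply: measurable_funX; exact: measurable_coord.
Qed.

Lemma integrable_weight n :
  (lebesgue_rV R n).-integrable setT (EFin \o @weight n).
Proof.
have mE k : measurable_fun setT (EFin \o @weight k).
  by apply/measurable_EFinP; exact: measurable_weight.
apply/integrableP; split; first exact: mE.
elim: n => [|n ih].
  (* In dimension 0 the measure is the Dirac mass at the only point, where the empty product is
     1. *)
  rewrite -[X in (X < _)%E]/(\int[@dirac _ 'rV[R]_0 (0%R : 'rV[R]_0) R]_z
    `|(EFin \o @weight 0) z|)%E.
  rewrite integral_dirac; [by rewrite diracT mul1e ltry|exact: measurableT|].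
  exact: measurableT_comp (mE _).
rewrite ge0_integral_rVS; [|by apply: measurableT_comp => //; exact: mE|by []].
under eq_integral => x _.
  under eq_integral => y _.
    rewrite /= weight_cons normrM EFinM.
    over.
  rewrite ge0_integralZl//=; last first.
    apply/measurable_EFinP; exact: measurableT_comp (@measurable_weight n).
  over.
rewrite ge0_integralZr//=.
- apply: lte_mul_pinfty => //.
  + exact: integral_ge0.
  + have /integrableP[_] := integrable_oneDsqrV.
    rewrite ge0_fin_numE//; exact: integral_ge0.
- apply/measurable_EFinP; apply: measurableT_comp => //.
  exact: (continuous_measurable_fun (@continuous_oneDsqrV R)).
- exact: integral_ge0.
Qed.

End weight.

(** * Integrals of derivatives vanish *)

Section integral_derivative.
Context (R : realType).
Notation leb := (@lebesgue_measure R).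

Lemma integrable_le_oneDsqrV (g : R -> R) (K : R) :
  measurable_fun setT g -> (forall t, `|g t| <= K / oneDsqr t) ->
  leb.-integrable setT (EFin \o g).
Proof.
move=> mg gK.
apply: (@le_integrable _ _ _ leb setT measurableT _
  (fun t => K%:E * ((oneDsqr t)^-1)%:E)%E).
- exact/measurable_EFinP.
- by move=> t _; rewrite -EFinM lee_fin; exact: le_trans (gK t) (ler_norm _).
- by apply: integrableZl => //; exact: integrable_oneDsqrV.
Qed.

Lemma integrable_le_weight n (g : 'rV[R]_n -> R) (K : R) :
  measurable_fun setT g -> (forall z, `|g z| <= K * weight z) ->
  (lebesgue_rV R n).-integrable setT (EFin \o g).
Proof.
move=> mg gK.
apply: (@le_integrable _ _ _ (lebesgue_rV R n) setT measurableT _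
  (fun z => K%:E * (weight z)%:E)%E).
- exact/measurable_EFinP.
- by move=> z _; rewrite -EFinM lee_fin; exact: le_trans (gK z) (ler_norm _).
- by apply: integrableZl => //; exact: integrable_weight.
Qed.

(** The integral of [g] over [-a, a] is h(a) - h(-a), which tends to 0 by the decay of [h]; the
    decay of [g] identifies the limit with the integral over the line. *)
Lemma integral_derivative_eq0 (h g : R -> R) (K : R) :
  (forall t : R, is_derive t (1 : R) h (g t)) -> continuous g ->
  (forall t, `|h t| <= K / oneDsqr t) -> (forall t, `|g t| <= K / oneDsqr t) ->
  (\int[leb]_t (g t)%:E = 0)%E.
Proof.
move=> hg cg hK gK.
have mg : measurable_fun setT g by exact: continuous_measurable_fun.
have ig := integrable_le_oneDsqrV mg gK.
rewrite -[LHS]fineK; last exact: integrable_fin_num.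
congr EFin; rewrite -/(Rintegral leb setT g).
pose f a t := g t * \1_(`[- a, a]%classic) t.
have K0 : 0 <= K.
  have := le_trans (normr_ge0 _) (hK 0).
  by rewrite pmulr_lge0// invr_gt0 oneDsqr_gt0.
have L : \int[leb]_t f a t @[a --> +oo] --> \int[leb]_t g t.
  apply: (@dominated_cvg_pinfty _ _ _ leb setT g (fun t => K / oneDsqr t)) => //.
  - apply: (@integrable_le_oneDsqrV _ K) => [|t].
      apply: measurable_funM => //.
      exact: (continuous_measurable_fun (@continuous_oneDsqrV R)).
    by rewrite ger0_norm// divr_ge0// oneDsqr_ge0.
  - move=> a; apply: measurable_funM => //; exact: measurable_indic.
  - move=> a t _; rewrite /f indicE; apply: le_trans (gK t).
    by case: (t \in _); rewrite ?mulr1// mulr0 normr0.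
  - move=> t _; apply: cvg_near_cst; near=> a.
    rewrite /f indicE mem_set ?mulr1//= in_itv /= -ler_norml.
    by near: a; exact: nbhs_pinfty_ge.
suff : \int[leb]_t f a t @[a --> +oo] --> 0.
  by move=> L0; exact: (cvg_unique (@Rhausdorff R) L L0).
apply/cvgrPdist_le => e e0; near=> a.
have a1 : 1 <= a by near: a; exact: nbhs_pinfty_ge.
have a0 : 0 < a by apply: lt_le_trans a1.
have -> : \int[leb]_t f a t = h a - h (- a).
  rewrite (_ : (fun t => f a t) = g \_ `[- a, a]); last first.
    by apply/funext => t; rewrite patchE /f indicE; case: (_ \in _);
       rewrite ?mulr1 ?mulr0.
  have ch : continuous h.
    by move=> t; apply: differentiable_continuous;
      apply/derivable1_diffP; exact: ex_derive.
  rewrite -Rintegral_mkcond /Rintegral (@continuous_FTC2 _ g h)//.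
  - by rewrite -subr_gt0 opprK addr_gt0.
  - exact: continuous_subspaceT.
  - split => [t _||]; first exact: ex_derive.
      by apply: cvg_at_right_filter; exact: ch.
    by apply: cvg_at_left_filter; exact: ch.
  - by move=> t _; rewrite derive1E derive_val.
rewrite sub0r normrN.
(* With a >= 1 this gives K / (1 + a^2) <= K / a <= e / 2, one half of [e] for each endpoint. *)
have a2 : 2 * K / e <= a by near: a; exact: (nbhs_pinfty_ge (num_real _)).
have B : K / oneDsqr a <= e / 2.
  rewrite ler_pdivrMr ?oneDsqr_gt0// /oneDsqr.
  move: a2; rewrite ler_pdivrMr// => a2.
  have : a <= a ^+ 2 by rewrite expr2 ler_peMl// ltW.
  by nra.
apply: le_trans (ler_normB _ _) _; rewrite (splitr e) lerD//.
  exact: le_trans (hK _) B.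
by apply: le_trans (hK _) _; rewrite /oneDsqr sqrrN.
Unshelve. all: by end_near.
Qed.

Lemma rV_cons_line0 n x (y : 'rV[R]_n) :
  rV_cons (x, y) = rV_cons (0, y) + x *: delta_mx 0 ord0.
Proof.
apply/rowP => i; rewrite [RHS]mxE [X in _ = _ + X]mxE [X in _ * X]mxE eqxx /=.
case: (unliftP ord0 i) => [j|] ->.
  by rewrite !rV_consES eq_sym (negbTE (neq_lift _ _)) mulr0 addr0.
by rewrite !rV_consE0 eqxx mulr1 add0r.
Qed.

Lemma rV_cons_line n x (y : 'rV[R]_n) t (k : 'I_n) :
  rV_cons (x, y + t *: delta_mx 0 k) =
  rV_cons (x, y) + t *: delta_mx 0 (lift ord0 k).
Proof.
apply/rowP => i; rewrite [RHS]mxE [X in _ = _ + X]mxE [X in _ * X]mxE eqxx /=.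
case: (unliftP ord0 i) => [j|] ->.
  by rewrite !rV_consES /= !mxE (inj_eq (@lift_inj _ _)).
by rewrite !rV_consE0 (negbTE (neq_lift _ _)) mulr0 addr0.
Qed.

Lemma measurable_rV_consr n (x : R) :
  measurable_fun setT (fun y : 'rV[R]_n => rV_cons (x, y)).
Proof.
apply: measurable_fun_rV => i; case: (unliftP ord0 i) => [j|] ->.
  under eq_fun do rewrite rV_consES.
  exact: measurable_coord.
under eq_fun do rewrite rV_consE0.
exact: measurable_cst.
Qed.

(** Fubini with direction [j] innermost, by induction on the dimension: along the head coordinate
    the orders are swapped; otherwise the head [x] is frozen and the induction hypothesis applies to
    the slice, with constant [K / oneDsqr x]. *)
Lemma integral_line_eq0 n (j : 'I_n) (g : 'rV[R]_n -> R) (K : R) :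
  measurable_fun setT g -> (forall z, `|g z| <= K * weight z) ->
  (forall z, (\int[leb]_t (g (z + t *: delta_mx 0 j))%:E = 0)%E) ->
  (\int[lebesgue_rV R n]_z (g z)%:E = 0)%E.
Proof.
elim: n j g K => [[]//|n ih] j g K mg gK gj.
have ig := integrable_le_weight mg gK.
case: (unliftP ord0 j) => [k|] jE; rewrite {}jE in gj.
  rewrite (integral_rVS ig) /=.
  under eq_integral => x _.
    rewrite (ih k (fun y => g (rV_cons (x, y))) (K / oneDsqr x)); first over.
    - apply: (measurableT_comp mg).
      exact: measurable_rV_consr.
    - by move=> y; apply: le_trans (gK _) _; rewrite weight_cons mulrA.
    - by move=> y; under eq_integral do rewrite rV_cons_line; exact: gj.
  by rewrite integral0.
rewrite (integral_rVS_swap ig).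
under eq_integral => y _.
  under eq_integral do rewrite /= rV_cons_line0.
  rewrite gj; over.
by rewrite integral0.
Qed.

End integral_derivative.

Lemma integrable_scaler d (T : measurableType d) (R : realType)
    (mu : {measure set T -> \bar R}) (D : set T) (k : R) (f : T -> R) :
  measurable D -> mu.-integrable D (EFin \o f) ->
  mu.-integrable D (EFin \o (fun x => k * f x)).
Proof.
by move=> mD /(integrableZl mD k).
Qed.

(** * Schwartz functions and their Fourier integrals *)

Section schwartz_functions.
Context (R : realType) (m : nat).
Implicit Types (f psi : 'rV[R]_m -> R).

Lemma pderivs_derive s (i : 'I_m) f :
  pderivs s (fun x => 'D_(delta_mx 0 i) f x) = pderivs (rcons s i) f.
Proof. by rewrite /pderivs -cats1 foldr_cat. Qed.

Lemma schwartz_derive f (i : 'I_m) :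
  schwartz_real f -> schwartz_real (fun x => 'D_(delta_mx 0 i) f x).
Proof.
move=> [sf bf]; split=> [s|alpha s]; rewrite pderivs_derive; first exact: sf.
exact: bf.
Qed.

(** Dividing by the weight means multiplying by the product of the 1 + x_i^2, a polynomial, so
    finitely many Schwartz seminorms suffice. A set [J] collects the factors from which the 1 is
    taken; [beta J] adds 2 to the exponents outside [J]. *)
Lemma schwartz_bound f (alpha : 'I_m -> nat) : schwartz_real f ->
  exists C, forall x : 'rV[R]_m,
    `|(\prod_(i < m) x 0 i ^+ alpha i) * f x| <= C * weight x.
Proof.
move=> [_ bf].
pose beta (J : {set 'I_m}) (i : 'I_m) := (alpha i + (i \notin J).*2)%N.
pose M J := projT1 (cid (bf (beta J) [::])).
exists (\sum_J M J) => x.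
pose w := \prod_(i < m) oneDsqr (x 0 i).
have w0 : 0 < w by apply: prodr_gt0 => i _; exact: oneDsqr_gt0.
have wE : weight x = w^-1.
  by rewrite /weight /w; elim/big_rec2: _ => [|i u v _ ->]; rewrite ?invr1// invfM.
rewrite wE ler_pdivlMr// -[X in _ * X](gtr0_norm w0) -normrM.
rewrite (_ : _ * w = \sum_(J : {set 'I_m})
    ((\prod_(i < m) x 0 i ^+ beta J i) * f x)).
  apply: le_trans (ler_norm_sum _ _ _) _; apply: ler_sum => J _.
  exact: projT2 (cid (bf (beta J) [::])) x.
rewrite -mulr_suml mulrAC; congr (_ * _).
rewrite /w /oneDsqr bigA_distr mulr_sumr; apply: eq_bigr => J _.
rewrite -big_split /=; apply: eq_bigr => i _.
by rewrite /beta exprD; case: (i \in J); rewrite ?expr0.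
Qed.

Lemma schwartz_le_weight f : schwartz_real f ->
  exists C, forall x : 'rV[R]_m, `|f x| <= C * weight x.
Proof.
move=> /(schwartz_bound (fun=> 0%N))[C fC]; exists C => x.
have := fC x; rewrite big1 ?mul1r// => i _; exact: expr0.
Qed.

Lemma schwartz_coord_le_weight f (i : 'I_m) : schwartz_real f ->
  exists C, forall x : 'rV[R]_m, `|x 0 i * f x| <= C * weight x.
Proof.
move=> /(schwartz_bound (fun j => nat_of_bool (j == i)))[C fC]; exists C => x.
have := fC x; rewrite (bigD1 i)//= eqxx expr1 big1 ?mulr1// => j /negbTE ->.
exact: expr0.
Qed.

Lemma schwartz_continuous f : schwartz_real f -> continuous f.
Proof. by move=> [sf _]; have [] := sf [::]. Qed.

Lemma schwartz_measurable f : schwartz_real f -> measurable_fun setT f.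
Proof. by move=> /schwartz_continuous; exact: continuous_measurable_fun_rV. Qed.

Lemma is_derive_line f (z v : 'rV[R]_m) (t : R) :
  derivable f (z + t *: v) v ->
  is_derive t (1 : R) (fun u => f (z + u *: v)) ('D_v f (z + t *: v)).
Proof.
move=> df.
have E : (fun h : R => h^-1 *: (((fun u : R => f (z + u *: v)) \o shift t)
    (h *: (1 : R)) - f (z + t *: v))) =
    (fun h : R => h^-1 *: ((f \o shift (z + t *: v)) (h *: v) - f (z + t *: v))).
  apply/funext => h /=; congr (_ *: (f _ - _)).
  by rewrite [h *: (1 : R)]mulr1 scalerDl addrCA.
by split; [rewrite /derivable E|rewrite /derive E].
Qed.

End schwartz_functions.

(** * Cosine integrals: boundedness, Lipschitz bound, decay of differences *)

Section fourier.
Context (R : realType) (m : nat).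
Implicit Types (psi : 'rV[R]_m -> R) (zeta : 'rV[R]_m).

Lemma cos_lipschitz (x y : R) : `|cos x - cos y| <= `|x - y|.
Proof.
wlog xy : x y / x < y => [H|].
  have [xy|xy|->] := ltgtP x y; first exact: H.
    by rewrite distrC (distrC x); exact: H.
  by rewrite !subrr.
have [|c _ E] := @MVT R cos (fun t => - sin t) x y xy.
  by apply: continuous_subspaceT; exact: continuous_cos.
rewrite distrC E normrM normrN (distrC x).
by rewrite ler_piMl// sin_max.
Qed.

Lemma dotvDl n (x y z : 'rV[R]_n) : dotv (x + y) z = dotv x z + dotv y z.
Proof. by rewrite /dotv -big_split; apply: eq_bigr => i _; rewrite mxE mulrDl. Qed.

Lemma dotvZl n a (x z : 'rV[R]_n) : dotv (a *: x) z = a * dotv x z.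
Proof. by rewrite /dotv mulr_sumr; apply: eq_bigr => i _; rewrite mxE mulrA. Qed.

Lemma dotv_delta n (i : 'I_n) (z : 'rV[R]_n) : dotv (delta_mx 0 i) z = z 0 i.
Proof.
rewrite /dotv (bigD1 i)//= mxE !eqxx mul1r big1 ?addr0// => j /negbTE ji.
by rewrite mxE ji andbF mul0r.
Qed.

Lemma measurable_dotv n (y : 'rV[R]_n) :
  measurable_fun setT (fun z : 'rV[R]_n => dotv z y).
Proof.
by apply: measurable_sum => i; apply: measurable_funM => //; exact: measurable_coord.
Qed.

(* The phase [a] lets one family of integrals cover both the cosine and the
   sine transform. *)
Definition cosint (a : R) psi zeta : R :=
  \int[lebesgue_rV R m]_z (cos (dotv z zeta + a) * psi z).

Lemma measurable_cos_dotv a zeta :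
  measurable_fun setT (fun z : 'rV[R]_m => cos (dotv z zeta + a)).
Proof.
apply: (measurableT_comp (f := @cos R)).
  exact: (continuous_measurable_fun (@continuous_cos R)).
by apply: measurable_funD => //; exact: measurable_dotv.
Qed.

Lemma cos_le_weight a psi zeta C : (forall z, `|psi z| <= C * weight z) ->
  forall z, `|cos (dotv z zeta + a) * psi z| <= C * weight z.
Proof.
move=> psiC z; apply: le_trans (psiC z).
by rewrite normrM ler_piMl// cos_max.
Qed.

Lemma integrable_cosint a psi zeta : schwartz_real psi ->
  (lebesgue_rV R m).-integrable setT
    (EFin \o (fun z => cos (dotv z zeta + a) * psi z)).
Proof.
move=> spsi; have [C psiC] := schwartz_le_weight spsi.
apply: (@integrable_le_weight _ _ _ C); last exact: cos_le_weight.
by apply: measurable_funM; [exact: measurable_cos_dotv|exact: schwartz_measurable].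
Qed.

Lemma Rintegral_le_weight (g : 'rV[R]_m -> R) K :
  measurable_fun setT g -> (forall z, `|g z| <= K * weight z) ->
  `|\int[lebesgue_rV R m]_z g z| <= K * \int[lebesgue_rV R m]_z weight z.
Proof.
move=> mg gK; have ig := integrable_le_weight mg gK.
apply: le_trans (le_normr_Rintegral _ ig) _ => //.
rewrite -RintegralZl//; last exact: integrable_weight.
apply: le_Rintegral => //; first exact: integrable_norm.
by apply: integrable_scaler => //; exact: integrable_weight.
Qed.

Lemma cosint_bounded a psi : schwartz_real psi ->
  exists C, forall zeta, `|cosint a psi zeta| <= C.
Proof.
move=> spsi; have [C psiC] := schwartz_le_weight spsi.
exists (C * \int[lebesgue_rV R m]_z weight z) => zeta.
apply: Rintegral_le_weight; last exact: cos_le_weight.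
by apply: measurable_funM; [exact: measurable_cos_dotv|exact: schwartz_measurable].
Qed.

(** Cosine is 1-Lipschitz and the two phases differ by the sum of z_i (zeta_i - zeta'_i); each
    factor z_i is absorbed by the decay of [psi]. *)
Lemma cosint_lipschitz a psi : schwartz_real psi ->
  exists C, forall zeta zeta',
    `|cosint a psi zeta - cosint a psi zeta'| <=
    C * \sum_(i < m) `|zeta 0 i - zeta' 0 i|.
Proof.
move=> spsi.
pose C i := projT1 (cid (schwartz_coord_le_weight i spsi)).
have CP i (x : 'rV[R]_m) : `|x 0 i * psi x| <= C i * weight x.
  exact: projT2 (cid (schwartz_coord_le_weight i spsi)) x.
have C0 i : 0 <= C i.
  have := le_trans (normr_ge0 _) (CP i 0).
  by rewrite pmulr_lge0// weight_gt0.
exists ((\sum_i C i) * \int[lebesgue_rV R m]_z weight z) => zeta zeta'.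
rewrite /cosint -RintegralB//; [|exact: integrable_cosint..].
rewrite mulrAC.
apply: Rintegral_le_weight => [|z].
  by apply: measurable_funB; apply: measurable_funM;
    [exact: measurable_cos_dotv|exact: schwartz_measurable|
     exact: measurable_cos_dotv|exact: schwartz_measurable].
rewrite -mulrBl normrM.
apply: (@le_trans _ _ (\sum_i `|zeta 0 i - zeta' 0 i| * `|z 0 i * psi z|)).
  apply: le_trans (ler_wpM2r (normr_ge0 _) (cos_lipschitz _ _)) _.
  rewrite opprD addrACA subrr addr0 /dotv -sumrB.
  apply: le_trans (ler_wpM2r (normr_ge0 _) (ler_norm_sum _ _ _)) _.
  rewrite mulr_suml; apply: ler_sum => i _.
  by rewrite -mulrBr !normrM mulrA (mulrC `|z 0 i|).
rewrite mulrAC mulr_sumr; apply: ler_sum => i _.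
rewrite mulrC ler_wpM2r//; apply: le_trans (CP i z) _.
rewrite ler_wpM2r//; first exact/ltW/weight_gt0.
by rewrite (bigD1 i)//= lerDl sumr_ge0.
Qed.

(* Integrate along lines in direction [i] the derivative of
   [zeta_i sin (<z, zeta> + a) psi + cos (<z, zeta> + a) d_i psi]. *)
Lemma cosint_derive2 a psi zeta (i : 'I_m) : schwartz_real psi ->
  zeta 0 i ^+ 2 * cosint a psi zeta =
  - cosint a (fun x => 'D_(delta_mx 0 i) (fun y => 'D_(delta_mx 0 i) psi y) x) zeta.
Proof.
move=> spsi.
pose d1 x := 'D_(delta_mx 0 i) psi x.
pose d2 x := 'D_(delta_mx 0 i) d1 x.
have sd1 : schwartz_real d1 by exact: schwartz_derive.
have sd2 : schwartz_real d2 by exact: schwartz_derive.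
have [C0 C0P] := schwartz_le_weight spsi.
have [C1 C1P] := schwartz_le_weight sd1.
have [C2 C2P] := schwartz_le_weight sd2.
pose c z := cos (dotv z zeta + a); pose s z := sin (dotv z zeta + a).
(* Differentiating [h] along the line gives [g]: the two mixed terms in [s * d1] cancel. A single
   primitive thus replaces two successive integrations by parts. *)
pose g z := zeta 0 i ^+ 2 * (c z * psi z) + c z * d2 z.
pose h z := zeta 0 i * (s z * psi z) + c z * d1 z.
have mc : measurable_fun setT c by exact: measurable_cos_dotv.
have mg : measurable_fun setT g.
  by apply: measurable_funD; [apply: measurable_funM => //|];
    apply: measurable_funM => //; exact: schwartz_measurable.
pose K := `|zeta 0 i| ^+ 2 * C0 + C2; pose K' := `|zeta 0 i| * C0 + C1.
have gK z : `|g z| <= K * weight z.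
  rewrite /g /K mulrDl; apply: le_trans (ler_normD _ _) _; apply: lerD.
    rewrite normrM normrX -mulrA ler_wpM2l ?exprn_ge0//; exact: cos_le_weight.
  exact: cos_le_weight.
have hK z : `|h z| <= K' * weight z.
  rewrite /h /K' mulrDl; apply: le_trans (ler_normD _ _) _; apply: lerD.
    rewrite normrM -mulrA ler_wpM2l//; apply: le_trans (C0P z).
    by rewrite normrM ler_piMl// sin_max.
  exact: cos_le_weight.
suff g0 : (\int[lebesgue_rV R m]_z (g z)%:E = 0)%E.
  apply/eqP; rewrite -addr_eq0 /cosint -RintegralZl//; last exact: integrable_cosint.
  rewrite -RintegralD//; last 2 first.
  - by apply: integrable_scaler => //; exact: integrable_cosint.
  - exact: integrable_cosint.
  by rewrite /Rintegral g0.
apply: (integral_line_eq0 (j := i) mg gK) => z.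
pose L t := z + t *: delta_mx 0 i : 'rV[R]_m.
have dL t : dotv (L t) zeta = dotv z zeta + t * zeta 0 i.
  by rewrite dotvDl dotvZl dotv_delta.
have dpsi t : is_derive t (1 : R) (psi \o L) (d1 (L t)).
  by apply: is_derive_line; have [sp _] := spsi; exact: (sp [::]).2.
have dd1 t : is_derive t (1 : R) (d1 \o L) (d2 (L t)).
  by apply: is_derive_line; have [sp _] := sd1; exact: (sp [::]).2.
have dA t : is_derive t (1 : R) (fun t => dotv (L t) zeta + a) (zeta 0 i).
  rewrite (_ : (fun t => _) = fun t => dotv z zeta + t * zeta 0 i + a); last first.
    by apply/funext => u; rewrite dL.
  by apply: is_derive_eq; rewrite add0r mul1r scaler0 add0r addr0 [_%:A]mulr1.
have dc t : is_derive t (1 : R) (c \o L) (- s (L t) * zeta 0 i).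
  rewrite (_ : c \o L = cos \o (fun t => dotv (L t) zeta + a))//.
  exact: is_derive1_comp.
have ds t : is_derive t (1 : R) (s \o L) (c (L t) * zeta 0 i).
  rewrite (_ : s \o L = sin \o (fun t => dotv (L t) zeta + a))//.
  exact: is_derive1_comp.
have cont (f : R -> R) (df : R -> R) :
    (forall t : R, is_derive t (1 : R) f (df t)) -> continuous f.
  move=> fdf t; apply: differentiable_continuous.
  by apply/derivable1_diffP; exact: ex_derive.
have cc := cont _ _ dc.
(* The third derivative of [psi] serves only to make [d2], hence [g], continuous along the line. *)
have dd2 t : is_derive t (1 : R) (d2 \o L) ('D_(delta_mx 0 i) d2 (L t)).
  by apply: is_derive_line; have [sp _] := sd2; exact: (sp [::]).2.
have cd2 := cont _ _ dd2.
(* An inequality of Peetre type: 1 + t^2 <= 2 (1 + x^2) (1 + (x + t)^2), the difference being the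
   sum of squares displayed below. The loss depends on [z], which is fixed along the line. *)
pose Kz := 2 * oneDsqr (z 0 i).
have wL t : weight (L t) <= Kz / oneDsqr t.
  apply: le_trans (weight_le _ i) _.
  rewrite ler_pdivlMr ?oneDsqr_gt0// mulrC ler_pdivrMr ?oneDsqr_gt0//.
  rewrite /Kz /oneDsqr /L !mxE !eqxx /= mulr1.
  set x := z 0 i; rewrite -subr_ge0.
  rewrite (_ : _ - _ = 1 + (x + (x + t)) ^+ 2 + 2 * (x * (x + t)) ^+ 2); last by ring.
  apply: addr_ge0; last by apply: mulr_ge0; [exact: ler0n|exact: sqr_ge0].
  by apply: addr_ge0; [exact: ler01|exact: sqr_ge0].
have bound (f : 'rV[R]_m -> R) (k : R) : (forall y, `|f y| <= k * weight y) ->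
    forall t, `|f (L t)| <= (k * Kz) / oneDsqr t.
  move=> fk t; apply: le_trans (fk _) _; rewrite -mulrA ler_wpM2l//.
  have := le_trans (normr_ge0 _) (fk z).
  by rewrite pmulr_lge0// weight_gt0.
pose M := Num.max (K' * Kz) (K * Kz).
have MP (u : R) t : u <= K' * Kz \/ u <= K * Kz -> u / oneDsqr t <= M / oneDsqr t.
  by rewrite ler_pM2r ?invr_gt0 ?oneDsqr_gt0// /M le_max => -[->|->]; rewrite ?orbT.
apply: (@integral_derivative_eq0 R (h \o L) (g \o L) M).
- move=> t.
  rewrite (_ : h \o L = (fun t => zeta 0 i * ((s \o L) t * (psi \o L) t)
    + (c \o L) t * (d1 \o L) t))//.
  apply: is_derive_eq; rewrite /g /=.
  by rewrite /GRing.scale /=; ring.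
- move=> t; rewrite /g; apply: cvgD; apply: cvgM.
  + exact: cvg_cst.
  + by apply: cvgM; [exact: cc|exact: (cont _ _ dpsi)].
  + exact: cc.
  + exact: cd2.
- by move=> t; apply: le_trans (bound _ _ hK t) _; apply: MP; left.
- by move=> t; apply: le_trans (bound _ _ gK t) _; apply: MP; right.
Qed.

(** The induction on [k] must let [psi] vary, since each step passes from [psi] to its pure second
    derivatives, which are again Schwartz. *)
Lemma cosint_decay a k psi : schwartz_real psi ->
  exists C, forall zeta zeta', dotv zeta zeta = dotv zeta' zeta' ->
    dotv zeta zeta ^+ k * `|cosint a psi zeta - cosint a psi zeta'| <=
    C * \sum_(i < m) `|zeta 0 i - zeta' 0 i|.
Proof.
elim: k psi => [|k ih] psi spsi.
  have [C CP] := cosint_lipschitz a spsi.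
  by exists C => zeta zeta' _; rewrite expr0 mul1r.
pose d2 i x := 'D_(delta_mx 0 i) (fun y => 'D_(delta_mx 0 i) psi y) x.
have sd2 i : schwartz_real (d2 i) by do 2 apply: schwartz_derive.
pose C i := projT1 (cid (ih _ (sd2 i))).
exists (\sum_i C i) => zeta zeta' zz.
have lap z : dotv z z * cosint a psi z = - \sum_i cosint a (d2 i) z.
  rewrite /dotv mulr_suml -sumrN; apply: eq_bigr => i _.
  by rewrite -expr2 cosint_derive2.
have zz0 : 0 <= dotv zeta zeta.
  by apply: sumr_ge0 => i _; rewrite -expr2 sqr_ge0.
rewrite exprSr -mulrA -[X in _ * (X * _)](ger0_norm zz0) -normrM mulrBr.
(* The equality of norms enters here: the factor in front of the value at [zeta'] becomes the
   squared norm of [zeta'], so the Laplacian identity applies at both points. *)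
rewrite {3}zz !lap opprK addrC -sumrB.
apply: le_trans (ler_wpM2l (exprn_ge0 _ zz0) (ler_norm_sum _ _ _)) _.
rewrite mulr_sumr mulr_suml; apply: ler_sum => i _.
rewrite distrC.
by have := projT2 (cid (ih _ (sd2 i))); apply.
Qed.

End fourier.

(** * The folded polar kernel *)

Section reflection.
Context (R : realType).
Notation leb := (@lebesgue_measure R).

Lemma measurable_reflect (c : R) : measurable_fun [set: measurableTypeR R]
  (fun x : measurableTypeR R => (c - x : measurableTypeR R)).
Proof. by apply: (@measurable_funB _ _ R [set: R] (cst c) id). Qed.

(** Lebesgue measure is determined by its values on half-open intervals. Reflection exchanges the
    open and the closed end but keeps the length. *)
Lemma lebesgue_reflect (c : R) (A : set R) : measurable A ->
  leb A = pushforward leb (fun x : measurableTypeR R => (c - x : measurableTypeR R)) A.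
Proof.
move=> mA.
pose mu := measure_function_pushforward__canonical__measure_function_Measure
     leb (@measurable_reflect c).
apply: (@lebesgue_measure_unique R mu) => // X [[a b] _ <-].
rewrite /mu /= /pushforward.
rewrite (_ : _ @^-1` _ = `[c - b, c - a[%classic); last first.
  by apply/seteqP; split => x /=; rewrite !in_itv /= => /andP[? ?]; apply/andP; lra.
rewrite !lebesgue_measure_itv /= !lte_fin ltrD2l ltrN2.
by case: ifP => // _; rewrite -!EFinB; congr EFin; ring.
Qed.

Lemma Rintegral_reflect (c : R) (A : set R) (f : R -> R) :
  measurable A -> measurable_fun setT f ->
  leb.-integrable ((fun x => c - x) @^-1` A) (EFin \o (fun x => f (c - x))) ->
  \int[leb]_(x in A) f x =
  \int[leb]_(x in (fun x => c - x) @^-1` A) f (c - x).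
Proof.
move=> mA mf fi; congr fine.
rewrite (eq_measure_integral
  (measure_function_pushforward__canonical__measure_function_Measure
     leb (@measurable_reflect c))).
  exact: (integral_pushforward (@measurable_reflect c)
    (proj2 (measurable_EFinP _ _) mf) fi mA).
by move=> B mB _; exact: lebesgue_reflect.
Qed.

End reflection.

(** Moves a truncation from the domain into the integrand, the form that dominated convergence
    requires. *)
Lemma Rintegral_setI_indic d (T : measurableType d) (R : realType)
    (mu : {measure set T -> \bar R}) (D P : set T) (f : T -> R) :
  \int[mu]_(x in D `&` P) f x = \int[mu]_(x in D) (f x * \1_P x).
Proof.
rewrite Rintegral_mkcondr; apply: eq_Rintegral => x _.
by rewrite patchE indicE; case: (x \in P); rewrite ?mulr1 ?mulr0.
Qed.

Section kernel.
Context (R : realType) (n : nat) (G : 'rV[R]_(n + n) -> R).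
Hypothesis mG : measurable_fun setT G.
Notation leb := (@lebesgue_measure R).
Notation V := ('rV[R]_n * 'rV[R]_n)%type.

(** The integrand in polar coordinates, Jacobian [r] included, for a real [G]; it is used with the
    real and the imaginary part of the inverse Fourier transform. On the diagonal the division by 0
    yields 0. *)
Definition kern (p : V) (r theta : R) : R :=
  let x := r * cos theta in let y := r * sin theta in
  x ^+ n.-1 * y ^+ n.-1 / (- x ^+ 2 + y ^+ 2) *
  G (row_mx (x *: p.1) (y *: p.2)) * r.

(* The fold under theta -> pi/2 - theta, which cancels the singularity of
   [kern] at theta = pi/4. *)
Definition sym_kern (p : V) (r theta : R) : R :=
  kern p r theta + kern p r (pi / 2 - theta).

(** Measurability is joint, directions included, because the iterated integral is later integrated
    over pairs of directions. *)
Lemma measurable_kern :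
  measurable_fun setT (fun q : V * R * R => kern q.1.1 q.1.2 q.2).
Proof.
have m11 : measurable_fun setT (fun q : V * R * R => q.1.1).
  exact: measurableT_comp measurable_fst measurable_fst.
have mr : measurable_fun setT (fun q : V * R * R => q.1.2).
  exact: measurableT_comp measurable_snd measurable_fst.
have mc : measurable_fun setT (fun q : V * R * R => q.1.2 * cos q.2).
  apply: measurable_funM => //; apply: (measurableT_comp (f := @cos R)) => //.
  exact: (continuous_measurable_fun (@continuous_cos R)).
have ms : measurable_fun setT (fun q : V * R * R => q.1.2 * sin q.2).
  apply: measurable_funM => //; apply: (measurableT_comp (f := @sin R)) => //.
  exact: (continuous_measurable_fun (@continuous_sin R)).
apply: measurable_funM => //; apply: measurable_funM.
  apply: measurable_funM; first by apply: measurable_funM; exact: measurable_funX.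
  apply: measurable_funVr; apply: measurable_funD; last exact: measurable_funX.
  by apply: measurable_funN; exact: measurable_funX.
apply: (measurableT_comp mG); apply: measurable_fun_rV => i.
case: (split_ordP i) => j ->.
  under eq_fun do rewrite row_mxEl mxE.
  apply: measurable_funM => //; apply: (measurableT_comp (measurable_coord j)).
  exact: (measurableT_comp measurable_fst m11).
under eq_fun do rewrite row_mxEr mxE.
apply: measurable_funM => //; apply: (measurableT_comp (measurable_coord j)).
exact: (measurableT_comp measurable_snd m11).
Qed.

Lemma measurable_kernr p r : measurable_fun setT (kern p r).
Proof. exact: (measurableT_comp measurable_kern (measurable_pair1 (p, r))). Qed.

Lemma measurable_sym_kern :
  measurable_fun setT (fun q : V * R * R => sym_kern q.1.1 q.1.2 q.2).
Proof.
apply: measurable_funD; first exact: measurable_kern.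
apply: (measurableT_comp measurable_kern
  (g := fun q : V * R * R => (q.1, pi / 2 - q.2))).
apply/measurable_fun_pairP; split; first exact: measurable_fst.
rewrite (_ : _ \o _ = fun q : V * R * R => pi / 2 - q.2)//.
by apply: measurable_funB.
Qed.

Lemma measurable_sym_kernr p r : measurable_fun setT (sym_kern p r).
Proof.
exact: (measurableT_comp measurable_sym_kern (measurable_pair1 (p, r))).
Qed.

Hypothesis decG : forall k, exists C, forall zeta zeta',
  dotv zeta zeta = dotv zeta' zeta' ->
  dotv zeta zeta ^+ k * `|G zeta - G zeta'| <=
  C * \sum_i `|zeta 0 i - zeta' 0 i|.

Lemma cos_reflect (t : R) : cos (pi / 2 - t) = sin t.
Proof. by rewrite cosB cos_pihalf sin_pihalf mul0r add0r mul1r. Qed.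

Lemma sin_reflect (t : R) : sin (pi / 2 - t) = cos t.
Proof. by rewrite sinB cos_pihalf sin_pihalf mul0r subr0 mul1r. Qed.

Lemma dotv_row_mx m (x y : 'rV[R]_m) a b :
  dotv (row_mx (a *: x) (b *: y)) (row_mx (a *: x) (b *: y)) =
  a ^+ 2 * dotv x x + b ^+ 2 * dotv y y.
Proof.
rewrite /dotv big_split_ord /=; congr (_ + _); rewrite mulr_sumr;
  apply: eq_bigr => i _; rewrite ?row_mxEl ?row_mxEr !mxE; ring.
Qed.

Lemma sphere_dotv m (x : 'rV[R]_m) : sphere R m x -> dotv x x = 1.
Proof.
rewrite /sphere /= /enorm => x1.
have dx : 0 <= dotv x x by apply: sumr_ge0 => i _; rewrite -expr2 sqr_ge0.
by rewrite -(sqr_sqrtr dx) x1 expr1n.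
Qed.

Lemma sphere_coord m (x : 'rV[R]_m) i : sphere R m x -> `|x 0 i| <= 1.
Proof.
move=> /sphere_dotv x1.
rewrite -(@ler_pXn2r _ 2)// ?nnegrE// expr1n real_normK ?num_real// -x1.
rewrite /dotv (bigD1 i)//= expr2 lerDl sumr_ge0// => j _.
by rewrite -expr2 sqr_ge0.
Qed.

(** The last bound follows from (cos t + sin t)^2 = 1 + 2 cos t sin t. *)
Lemma cos_sin_pi4 (t : R) : 0 <= t < pi / 4 ->
  [/\ 0 <= sin t, sin t < cos t & 1 <= cos t + sin t].
Proof.
move=> /andP[t0 t4].
have pi0 := @pi_gt0 R.
have s0 : 0 <= sin t by apply: sin_ge0_pi; apply/andP; split => //; lra.
have sc : sin t < cos t.
  rewrite -sin_reflect ltr_sin ?in_itv /=; [lra|apply/andP; split; lra..].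
split => //; have := cos2Dsin2 t; nra.
Qed.

(** Reflection swaps cosine and sine: the monomial factor is unchanged while -x^2 + y^2 changes
    sign, so the two terms become a difference of values of [G]. The power of [r] is kept as a power
    of r^2 to match [decG]. *)
Lemma sym_kernE (p : V) (r t : R) : 0 < r -> 0 <= t < pi / 4 ->
  let c := cos t in let s := sin t in
  sym_kern p r t = (c * s) ^+ n.-1 / (r * (c - s) * (c + s)) *
    ((r ^+ 2) ^+ n.-1 * (G (row_mx ((r * s) *: p.1) ((r * c) *: p.2)) -
      G (row_mx ((r * c) *: p.1) ((r * s) *: p.2)))).
Proof.
move=> r0 t4 c s; have [s0 sc cs1] := cos_sin_pi4 t4.
rewrite /sym_kern /kern cos_reflect sin_reflect -/c -/s.
rewrite !exprMn.
have r' : r != 0 by rewrite gt_eqF.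
have d1 : c - s != 0 by rewrite subr_eq0 gt_eqF.
have d2 : c + s != 0 by rewrite gt_eqF// (lt_le_trans ltr01).
have d3 : - (r * c) ^+ 2 + (r * s) ^+ 2 != 0.
  rewrite (_ : _ + _ = - (r ^+ 2 * ((c - s) * (c + s)))); last by ring.
  by rewrite oppr_eq0 !mulf_neq0// expf_neq0.
have d4 : - (r * s) ^+ 2 + (r * c) ^+ 2 != 0.
  rewrite (_ : _ + _ = r ^+ 2 * ((c - s) * (c + s))); last by ring.
  by rewrite !mulf_neq0// expf_neq0.
move: (r ^+ n.-1) (c ^+ n.-1) (s ^+ n.-1) => rn cn sn.
by field; rewrite r' d1 d2 d3 d4.
Qed.

Lemma sym_kern_bound : exists K,
  forall p r t, sphere R n p.1 -> sphere R n p.2 -> 0 < r -> 0 <= t < pi / 4 ->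
    `|sym_kern p r t| <= K / oneDsqr r.
Proof.
have [C1 C1P] := decG n.-1; have [C2 C2P] := decG n.-1.+1.
(* [C1] and [C2] pay for the terms 1 and r^2 of [oneDsqr r]. Each of the n + n coordinates of
   [z - z'] is at most r (cos t - sin t) in absolute value, because coordinates of unit vectors are
   at most 1; hence [K] does not depend on [p]. *)
pose K := (`|C1| + `|C2|) * (n%:R + n%:R).
exists K => p r t p1 p2 r0 t4.
rewrite sym_kernE//; have [s0 sc cs1] := cos_sin_pi4 t4.
set c := cos t in sc cs1 *; set s := sin t in s0 sc cs1 *.
set z := row_mx _ _; set z' := row_mx _ _.
have zE : dotv z z = r ^+ 2.
  rewrite dotv_row_mx !sphere_dotv// !mulr1 !exprMn -mulrDr addrC cos2Dsin2.
  by rewrite mulr1.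
have zE' : dotv z' z' = r ^+ 2.
  rewrite dotv_row_mx !sphere_dotv// !mulr1 !exprMn -mulrDr cos2Dsin2.
  by rewrite mulr1.
have d0 : 0 < c - s by rewrite subr_gt0.
have S : \sum_i `|z 0 i - z' 0 i| <= r * (c - s) * (n%:R + n%:R).
  have E x : r * s * x - r * c * x = - (r * (c - s)) * x by ring.
  have E' x : r * c * x - r * s * x = r * (c - s) * x by ring.
  have rd0 : 0 <= r * (c - s) by apply/ltW/mulr_gt0.
  rewrite big_split_ord /= mulrDr; apply: lerD.
    rewrite mulr_natr -[X in _ *+ X]card_ord -sumr_const; apply: ler_sum => i _.
    rewrite !row_mxEl !mxE E normrM normrN (ger0_norm rd0) ler_piMr//.
    exact: sphere_coord.
  rewrite mulr_natr -[X in _ *+ X]card_ord -sumr_const; apply: ler_sum => i _.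
  rewrite !row_mxEr !mxE E' normrM (ger0_norm rd0) ler_piMr//.
  exact: sphere_coord.
have D k C : (forall zeta zeta', dotv zeta zeta = dotv zeta' zeta' ->
    dotv zeta zeta ^+ k * `|G zeta - G zeta'| <=
    C * \sum_i `|zeta 0 i - zeta' 0 i|) ->
    (r ^+ 2) ^+ k * `|G z - G z'| <= `|C| * (r * (c - s) * (n%:R + n%:R)).
  move=> CP; rewrite -{1}zE; apply: le_trans (CP _ _ _) _; first by rewrite zE zE'.
  apply: le_trans (ler_wpM2r _ (ler_norm C)) _; first exact: sumr_ge0.
  exact: ler_wpM2l.
have D1 := D _ _ C1P; have D2 := D _ _ C2P.
have rd0 : 0 < r * (c - s) by exact: mulr_gt0.
have c0 : 0 <= c by apply: ltW; apply: le_lt_trans sc.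
have cs0 : 0 < c + s by apply: lt_le_trans cs1.
have cs_le1 : (c * s) ^+ n.-1 <= 1.
  rewrite exprn_ile1// ?mulr_ge0// mulr_ile1//; [exact: cos_le1|exact: sin_le1].
rewrite ler_pdivlMr ?oneDsqr_gt0// normrM [X in X * _](_ : _ =
    (c * s) ^+ n.-1 / (r * (c - s) * (c + s)) * ((r ^+ 2) ^+ n.-1 * `|G z - G z'|)).
  pose X := (r ^+ 2) ^+ n.-1 * `|G z - G z'| * oneDsqr r.
  rewrite -[leLHS]mulrA -/X.
  have XK : X <= r * (c - s) * K.
    rewrite /X /oneDsqr mulrDr mulr1 [_ * `|_| * _]mulrAC -exprSr.
    by apply: le_trans (lerD D1 D2) _; rewrite -mulrDl /K mulrCA.
  have X0 : 0 <= X.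
    by rewrite /X !mulr_ge0 ?oneDsqr_ge0// exprn_ge0// sqr_ge0.
  apply: (@le_trans _ _ (1 / (r * (c - s)) * X)).
    rewrite ler_wpM2r// ler_pM// ?invr_ge0 ?mulr_ge0 ?exprn_ge0 ?mulr_ge0
      ?(ltW r0) ?(ltW d0) ?(ltW cs0)//.
    rewrite lef_pV2 ?posrE ?mulr_gt0//.
    by rewrite ler_peMr// ltW.
  by rewrite mul1r mulrC ler_pdivrMr// mulrC.
rewrite ger0_norm; last first.
  by rewrite divr_ge0 ?exprn_ge0 ?mulr_ge0// ltW.
by rewrite normrM (ger0_norm (exprn_ge0 _ (sqr_ge0 _))).
Qed.

Hypothesis bndG : exists B, forall zeta, `|G zeta| <= B.

Lemma integrable_bounded_itv (u v M : R) (D : set R) (f : R -> R) :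
  measurable D -> D `<=` `[u, v] -> measurable_fun D f ->
  (forall x, D x -> `|f x| <= M) -> leb.-integrable D (EFin \o f).
Proof.
move=> mD Duv mf fM; apply: measurable_bounded_integrable => //.
  apply: (@le_lt_trans _ _ (leb `[u, v]%classic)).
    by apply: le_measure; rewrite ?inE.
  by rewrite lebesgue_measure_itv /=; case: ifP => _; rewrite ?ltry// -EFinB ltry.
exists M; split; rewrite ?num_real// => x Mx y Dy.
by apply: le_trans (ltW Mx); exact: fM.
Qed.

(** [octant] is the fixed domain of the folded integral; the cut [below a] is a separate set so that
    it can turn into an indicator tending to 1. Leaving out pi / 4 makes that limit hold at every
    point. *)
Definition octant : set R := `[0, pi / 4[%classic.
Definition below (a : R) : set R := [set t | t <= pi / 4 - a^-1].

Lemma measurable_octant : measurable octant.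
Proof. exact: measurable_itv. Qed.

Lemma measurable_below a : measurable (below a).
Proof.
rewrite (_ : below a = `]-oo, (pi / 4 - a^-1)]%classic).
  exact: measurable_itv.
by apply/seteqP; split => x /=; rewrite in_itv.
Qed.

Lemma octant_below a : 0 < a ->
  octant `&` below a = `[0, (pi / 4 - a^-1)]%classic.
Proof.
rewrite -invr_gt0 /octant /below => a0; apply/seteqP; split => t /=; rewrite !in_itv /=.
  by move=> [/andP[t0 _] tb]; apply/andP.
by move=> /andP[t0 tb]; split=> //; apply/andP; split => //; lra.
Qed.

Lemma octant_belowP t a : (octant `&` below a) t -> 0 <= t < pi / 4.
Proof. by rewrite /octant /= in_itv /= => -[]. Qed.

Lemma octant_below_itv a : octant `&` below a `<=` `[0, pi]%classic.
Proof.
move=> t /octant_belowP /andP[t0 t4] /=; rewrite in_itv /= t0 /=.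
by have := @pi_gt0 R; lra.
Qed.

Lemma pv_sectorE a : 4 <= a ->
  pv_sector a = octant `&` below a `|`
    (fun t => pi / 2 - t) @^-1` (octant `&` below a).
Proof.
move=> a4; have a0 : 0 < a by apply: lt_le_trans a4.
have ia0 : 0 < a^-1 by rewrite invr_gt0.
rewrite octant_below// /pv_sector; apply/seteqP; split => t /=; rewrite !in_itv /=.
  have [t4|t4] := lerP t (pi / 4).
    by move=> /andP[? ?]; left; apply/andP; lra.
  by move=> /andP[? ?]; right; apply/andP; lra.
move=> [/andP[? ?]|/andP[? ?]].
  by rewrite ger0_norm ?subr_ge0; [apply/andP; lra|lra].
by rewrite ler0_norm ?subr_le0; [apply/andP; lra|lra].
Qed.

Lemma measurable_reflect_octant_below a :
  measurable ((fun t => pi / 2 - t) @^-1` (octant `&` below a)).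
Proof.
rewrite -[X in measurable X]setTI.
apply: (@measurable_reflect R (pi / 2) measurableT).
by apply: measurableI; [exact: measurable_octant|exact: measurable_below].
Qed.

Lemma measurable_octant_below a : measurable (octant `&` below a).
Proof. by apply: measurableI; [exact: measurable_octant|exact: measurable_below]. Qed.

(** The difference of squares is at least cos t - sin t, which decreases on the octant; its value at
    the endpoint pi / 4 - 1/a is the bound. If that endpoint is negative the set is empty and 1 will
    do. *)
Lemma cos_sin_below a : 0 < a -> exists2 e, 0 < e &
  forall t, (octant `&` below a) t -> e <= cos t ^+ 2 - sin t ^+ 2.
Proof.
move=> a0; have pi0 := @pi_gt0 R.
have ia0 : 0 < a^-1 by rewrite invr_gt0.
pose u := pi / 4 - a^-1; have [u0|u0] := ltrP u 0.
  exists 1 => // t [/=]; rewrite /octant /= in_itv /= => /andP[t0 _] tb.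
  by have := le_lt_trans (le_trans t0 tb) u0; rewrite ltxx.
have u4 : 0 <= u < pi / 4 by rewrite u0 /u /=; lra.
have [su scu _] := cos_sin_pi4 u4.
exists (cos u - sin u) => [|t tb]; first by rewrite subr_gt0.
have t4 := octant_belowP tb; have [st sct cs1] := cos_sin_pi4 t4.
have tu : t <= u by case: tb.
have [t0 t4'] := andP t4.
have cut : cos u <= cos t.
  by rewrite leNgt ltr_cos ?in_itv /= -?leNgt//; apply/andP; split; lra.
have sut : sin t <= sin u.
  by rewrite leNgt ltr_sin ?in_itv /= -?leNgt//; apply/andP; split; lra.
rewrite subr_sqr; apply: (@le_trans _ _ (cos t - sin t)); first exact: lerB.
by rewrite ler_peMr// subr_ge0 ltW.
Qed.

(** No cancellation is used, so the bound depends on [a] and [r]; it serves only to make the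
    integrals over a truncated sector exist. *)
Lemma kern_bound a r : 0 < a -> 0 < r -> exists M, forall (p : V) t,
  (octant `&` below a) t -> `|kern p r t| <= M /\ `|kern p r (pi / 2 - t)| <= M.
Proof.
move=> a0 r0; have [e e0 eP] := cos_sin_below a0; have [B BP] := bndG.
have gen (p : V) t : e <= `|cos t ^+ 2 - sin t ^+ 2| ->
    `|kern p r t| <= r ^+ n.-1 * r ^+ n.-1 / (r ^+ 2 * e) * B * r.
  move=> et; rewrite /kern !normrM (ger0_norm (ltW r0)) ler_wpM2r ?(ltW r0)//.
  have X u : `|u| <= 1 -> `|(r * u) ^+ n.-1| <= r ^+ n.-1.
    move=> u1; rewrite normrX lerXn2r ?nnegrE ?(ltW r0)//.
    by rewrite normrM (ger0_norm (ltW r0)) ler_piMr// ltW.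
  apply: ler_pM => //; apply: ler_pM => //.
    by apply: ler_pM => //; apply: X; [exact: cos_max|exact: sin_max].
  rewrite normfV lef_pV2 ?posrE ?mulr_gt0 ?exprn_gt0//.
    rewrite (_ : _ + _ = - (r ^+ 2 * (cos t ^+ 2 - sin t ^+ 2))); last by ring.
    by rewrite normrN normrM normrX (gtr0_norm r0) ler_wpM2l// exprn_ge0// ltW.
  rewrite (_ : _ + _ = - (r ^+ 2 * (cos t ^+ 2 - sin t ^+ 2))); last by ring.
  rewrite normrN normrM normrX (gtr0_norm r0) mulr_gt0// ?exprn_gt0//.
  exact: lt_le_trans et.
eexists => p t tb; split; apply: gen.
  exact: le_trans (eP _ tb) (ler_norm _).
rewrite cos_reflect sin_reflect distrC.
exact: le_trans (eP _ tb) (ler_norm _).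
Qed.

Lemma integrable_kern_below a p r : 0 < a -> 0 < r ->
  leb.-integrable (octant `&` below a) (EFin \o kern p r) /\
  leb.-integrable (octant `&` below a) (EFin \o (fun t => kern p r (pi / 2 - t))).
Proof.
move=> a0 r0; have [M MP] := kern_bound a0 r0.
have mk := measurable_kernr p r.
split; apply: (@integrable_bounded_itv 0 pi M).
- exact: measurable_octant_below.
- exact: octant_below_itv.
- exact: measurable_funTS.
- by move=> t /(MP p)[].
- exact: measurable_octant_below.
- exact: octant_below_itv.
- apply: measurable_funTS; apply: (measurableT_comp mk).
  exact: measurable_reflect.
- by move=> t /(MP p)[].
Qed.

Lemma integrable_kern_sector a p r : 4 <= a -> 0 < r ->
  leb.-integrable (pv_sector a) (EFin \o kern p r).
Proof.
move=> a4 r0; have a0 : 0 < a by apply: lt_le_trans a4.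
have [M MP] := kern_bound a0 r0; rewrite pv_sectorE//.
apply: (@integrable_bounded_itv 0 pi M).
- by apply: measurableU; [exact: measurable_octant_below|
    exact: measurable_reflect_octant_below].
- have pi0 := @pi_gt0 R.
  move=> t [/octant_below_itv//|/octant_belowP/andP[? ?]].
  by rewrite /= in_itv /=; apply/andP; lra.
- exact: measurable_funTS (measurable_kernr p r).
- move=> t [/(MP p)[]//|/(MP p)[_]].
  by rewrite opprB addrC subrK.
Qed.

(** The fold itself: the sector is symmetric about pi / 4, its upper half is reflected onto the
    truncated octant, and the two integrals are added, each of them being finite at fixed [a]. *)
Lemma Rintegral_kern_sector a p r : 4 <= a -> 0 < r ->
  \int[leb]_(t in pv_sector a) kern p r t =
  \int[leb]_(t in octant `&` below a) sym_kern p r t.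
Proof.
move=> a4 r0; have a0 : 0 < a by apply: lt_le_trans a4.
have ia0 : 0 < a^-1 by rewrite invr_gt0.
have := integrable_kern_sector p a4 r0.
have [i1 i2] := integrable_kern_below p a0 r0.
rewrite pv_sectorE// => ik.
have mhb := measurable_octant_below a.
rewrite Rintegral_setU//; last 2 first.
- exact: measurable_reflect_octant_below.
- apply/disj_setPRL => t /octant_belowP /andP[_ t4] /octant_belowP /andP[_].
  by lra.
rewrite (@Rintegral_reflect R (pi / 2)
  ((fun t => pi / 2 - t) @^-1` (octant `&` below a))).
- rewrite -comp_preimage (_ : _ \o _ = id); last first.
    by apply/funext => t /=; rewrite opprB addrC subrK.
  by rewrite preimage_id -RintegralD.
- exact: measurable_reflect_octant_below.
- exact: measurable_kernr.
- rewrite -comp_preimage (_ : _ \o _ = id) ?preimage_id//.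
  by apply/funext => t /=; rewrite opprB addrC subrK.
Qed.

Notation quadrant := (`]0, +oo[%classic : set R).

(** The value of the principal value, with the cuts removed. For [p] on the spheres the bound on
    [sym_kern] makes both integrals absolutely convergent. *)
Definition pv_kern (p : V) : R :=
  \int[leb]_(r in quadrant) \int[leb]_(t in octant) sym_kern p r t.

Lemma measurable_Rintegral_sym_kern :
  measurable_fun setT (fun q : V * R => \int[leb]_(t in octant) sym_kern q.1 q.2 t).
Proof.
exact: (@measurable_fun_Rintegral _ _ _ _ R leb octant
  (fun q : V * R * R => sym_kern q.1.1 q.1.2 q.2)
  measurable_octant measurable_sym_kern).
Qed.

Lemma measurable_pv_kern : measurable_fun setT pv_kern.
Proof.
exact: (@measurable_fun_Rintegral _ _ _ _ R leb quadrant
  (fun q : V * R => \int[leb]_(t in octant) sym_kern q.1 q.2 t)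
  (measurable_itv _) measurable_Rintegral_sym_kern).
Qed.

Lemma measurable_cut_sym_kern p a : measurable_fun setT
  (fun r => \int[leb]_(t in octant) (sym_kern p r t * \1_(below a) t)).
Proof.
apply: (@measurable_fun_Rintegral _ _ _ _ R leb octant
  (fun q : R * R => sym_kern p q.1 q.2 * \1_(below a) q.2) measurable_octant _).
apply: measurable_funM; last first.
  by apply: (measurableT_comp (measurable_indic (measurable_below a))).
apply: (measurableT_comp measurable_sym_kern
  (g := fun q : R * R => (p, q.1, q.2))).
apply/measurable_fun_pairP; split; last exact: measurable_snd.
apply/measurable_fun_pairP; split; first exact: measurable_cst.
exact: measurable_fst.
Qed.

Lemma lebesgue_octant : leb octant = (pi / 4)%:E.
Proof.
by rewrite lebesgue_measure_itv /= lte_fin divr_gt0 ?pi_gt0// -EFinB subr0.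
Qed.

Lemma integrable_octant M (f : R -> R) : measurable_fun setT f ->
  (forall t, octant t -> `|f t| <= M) -> leb.-integrable octant (EFin \o f).
Proof.
move=> mf fM; apply: (@integrable_bounded_itv 0 pi M) => //.
- exact: measurable_octant.
- move=> t; rewrite /octant /= !in_itv /= => /andP[-> t4] /=.
  by have := @pi_gt0 R; lra.
- exact: measurable_funTS.
Qed.

Lemma Rintegral_octant_le M (f : R -> R) : measurable_fun setT f ->
  (forall t, octant t -> `|f t| <= M) -> `|\int[leb]_(t in octant) f t| <= M * (pi / 4).
Proof.
move=> mf fM; have mh := measurable_octant.
have fi := integrable_octant mf fM.
apply: le_trans (le_normr_Rintegral _ fi) _ => //.
have -> : M * (pi / 4) = \int[leb]_(t in octant) M.
  rewrite Rintegral_cst//; congr (_ * _).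
  by rewrite -[LHS]/(fine (pi / 4)%:E) -lebesgue_octant.
apply: le_Rintegral => //; first exact: integrable_norm.
apply: (@integrable_octant `|M|) => //.
Qed.

(** * Removing the cuts for a fixed pair of directions *)

Section at_point.
Variables (K : R) (p : V).
Hypothesis symK : forall r t, 0 < r -> 0 <= t < pi / 4 ->
  `|sym_kern p r t| <= K / oneDsqr r.

Lemma cut_sym_kern_bound a r t : 0 < r -> octant t ->
  `|sym_kern p r t * \1_(below a) t| <= K / oneDsqr r.
Proof.
move=> r0; rewrite /octant /= in_itv /= => t4; apply: le_trans (symK r0 t4).
by rewrite normrM ler_piMr// indicE; case: (_ \in _); rewrite ?normr1 ?normr0.
Qed.

Lemma integral_cut_bound a r : 0 < r ->
  `|\int[leb]_(t in octant) (sym_kern p r t * \1_(below a) t)| <=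
  K / oneDsqr r * (pi / 4).
Proof.
move=> r0; apply: Rintegral_octant_le => [|t ht]; last exact: cut_sym_kern_bound.
apply: measurable_funM; first exact: measurable_sym_kernr.
exact: measurable_indic (measurable_below a).
Qed.

Lemma integral_sym_kern_bound r : 0 < r ->
  `|\int[leb]_(t in octant) sym_kern p r t| <= K / oneDsqr r * (pi / 4).
Proof.
move=> r0; apply: Rintegral_octant_le => [|t]; first exact: measurable_sym_kernr.
by rewrite /octant /= in_itv /=; exact: symK.
Qed.

Lemma integrable_bound (D : set (measurableTypeR R)) : measurable D ->
  leb.-integrable D (EFin \o (fun r => K / oneDsqr r * (pi / 4))).
Proof.
move=> mD; apply: (@integrableS _ _ _ _ setT) => //.
have := integrable_scaler (K * (pi / 4)) measurableT (@integrable_oneDsqrV R).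
by congr (integrable _ _ (_ \o _)); apply/funext => r; rewrite mulrAC.
Qed.

(** The right-hand side depends on [p] only through [K]; a common [K] therefore bounds the principal
    value uniformly over pairs of directions. *)
Lemma pv_kern_bound : `|pv_kern p| <=
  \int[leb]_(r in quadrant) (K / oneDsqr r * (pi / 4)).
Proof.
have mq : measurable (quadrant : set (measurableTypeR R)) by exact: measurable_itv.
have mI : measurable_fun setT (fun r => \int[leb]_(t in octant) sym_kern p r t).
  exact: (measurableT_comp measurable_Rintegral_sym_kern (measurable_pair1 p)).
have iI : leb.-integrable quadrant
    (EFin \o (fun r => \int[leb]_(t in octant) sym_kern p r t)).
  apply: (@le_integrable _ _ _ _ _ mq _ _ _ _ (integrable_bound mq)).
    by apply/measurable_EFinP; exact: measurable_funTS.
  move=> r /=; rewrite in_itv /= andbT => r0.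
  by rewrite lee_fin; apply: le_trans (ler_norm _); exact: integral_sym_kern_bound.
apply: le_trans (le_normr_Rintegral _ iI) _ => //.
apply: le_Rintegral => //.
- exact: integrable_norm.
- exact: integrable_bound.
- by move=> r /=; rewrite in_itv /= andbT; exact: integral_sym_kern_bound.
Qed.

Lemma cvg_integral_cut r : 0 < r ->
  \int[leb]_(t in octant) (sym_kern p r t * \1_(below a) t) @[a --> +oo] -->
  \int[leb]_(t in octant) sym_kern p r t.
Proof.
move=> r0; apply: (@dominated_cvg_pinfty _ _ _ leb octant (sym_kern p r)
  (fun=> K / oneDsqr r)).
- exact: measurable_octant.
- exact: measurable_funTS (measurable_sym_kernr p r).
- by apply: (@integrable_octant `|K / oneDsqr r|).
- move=> a; apply: measurable_funTS; apply: measurable_funM.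
    exact: measurable_sym_kernr.
  exact: measurable_indic (measurable_below a).
- by move=> a t ht; exact: cut_sym_kern_bound.
- move=> t; rewrite /octant /= in_itv /= => /andP[t0 t4]; apply: cvg_near_cst.
  near=> a; rewrite indicE mem_set ?mulr1// /below /=.
  have d0 : 0 < pi / 4 - t by rewrite subr_gt0.
  (* From this [a] on, the point [t] lies inside the cut. *)
  have da : (pi / 4 - t)^-1 <= a by near: a; exact: (nbhs_pinfty_ge (num_real _)).
  have a0 : 0 < a by apply: lt_le_trans da; rewrite invr_gt0.
  rewrite lerBrDr -lerBrDl -[leRHS]invrK lef_pV2 ?posrE ?invr_gt0//.
Unshelve. all: by end_near.
Qed.

Lemma pv_truncated_kernE a : 4 <= a ->
  \int[leb]_(r in `[a^-1, a]) \int[leb]_(t in pv_sector a) kern p r t =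
  \int[leb]_(r in quadrant) ((\int[leb]_(t in octant)
    (sym_kern p r t * \1_(below a) t)) * \1_(`[a^-1, a]%classic) r).
Proof.
move=> a4; have a0 : 0 < a by apply: lt_le_trans a4.
have ia0 : 0 < a^-1 by rewrite invr_gt0.
rewrite -Rintegral_setI_indic (_ : _ `&` _ = `[a^-1, a]%classic); last first.
  apply/seteqP; split => r /=; rewrite !in_itv /= ?andbT; first by case.
  by move=> /andP[ar ra]; split; [exact: lt_le_trans ar|rewrite ar].
apply: eq_Rintegral => r; rewrite inE /= in_itv /= => /andP[ar _].
have r0 : 0 < r by apply: lt_le_trans ar.
by rewrite -Rintegral_setI_indic Rintegral_kern_sector.
Qed.

(** The same [a] governs both cuts, so the inner integral moves together with the radial window.
    Dominated convergence in the angle gives the pointwise limit in [r]; a second one in [r], with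
    majorant a multiple of 1 / (1 + r^2), finishes. *)
Lemma cvg_pv_truncated_kern :
  \int[leb]_(r in `[a^-1, a]) \int[leb]_(t in pv_sector a) kern p r t
    @[a --> +oo] --> pv_kern p.
Proof.
have mq : measurable (quadrant : set (measurableTypeR R)) by exact: measurable_itv.
have L : \int[leb]_(r in quadrant) ((\int[leb]_(t in octant)
    (sym_kern p r t * \1_(below a) t)) * \1_(`[a^-1, a]%classic) r)
    @[a --> +oo] --> pv_kern p.
  apply: (dominated_cvg_pinfty mq _ (integrable_bound mq)).
  - apply: measurable_funTS.
    exact: (measurableT_comp measurable_Rintegral_sym_kern (measurable_pair1 p)).
  - move=> a; apply: measurable_funTS; apply: measurable_funM.
      exact: measurable_cut_sym_kern.
    exact: measurable_indic.
  - move=> a r /=; rewrite in_itv /= andbT => r0.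
    apply: le_trans (integral_cut_bound a r0).
    by rewrite normrM ler_piMr// indicE; case: (_ \in _); rewrite ?normr1 ?normr0.
  - move=> r /=; rewrite in_itv /= andbT => r0.
    rewrite -[X in _ --> X]mulr1; apply: cvgM; first exact: cvg_integral_cut.
    apply: cvg_near_cst; near=> a; rewrite indicE mem_set//= in_itv /=.
    have ra : r <= a by near: a; exact: (nbhs_pinfty_ge (num_real _)).
    have ra' : r^-1 <= a by near: a; exact: (nbhs_pinfty_ge (num_real _)).
    have a0 : 0 < a by exact: lt_le_trans ra.
    by rewrite ra andbT -[leRHS]invrK lef_pV2 ?posrE ?invr_gt0.
apply: cvg_trans L; apply: near_eq_cvg; near=> a.
apply/esym/pv_truncated_kernE.
by near: a; exact: (nbhs_pinfty_ge (num_real _)).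
Unshelve. all: by end_near.
Qed.

Lemma integrable_Rintegral_sector a : 4 <= a ->
  leb.-integrable `[a^-1, a]
    (EFin \o (fun r => \int[leb]_(t in pv_sector a) kern p r t)).
Proof.
move=> a4; have a0 : 0 < a by apply: lt_le_trans a4.
have ia0 : 0 < a^-1 by rewrite invr_gt0.
have mI : measurable (`[a^-1, a]%classic : set (measurableTypeR R)).
  exact: measurable_itv.
have E r : `[a^-1, a]%classic r -> \int[leb]_(t in pv_sector a) kern p r t =
    \int[leb]_(t in octant) (sym_kern p r t * \1_(below a) t).
  rewrite /= in_itv /= => /andP[ar _].
  rewrite Rintegral_kern_sector ?Rintegral_setI_indic//.
  exact: lt_le_trans ar.
apply: (@eq_integrable _ _ _ leb _ mI (EFin \o (fun r =>
    \int[leb]_(t in octant) (sym_kern p r t * \1_(below a) t)))).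
  by move=> r; rewrite inE => /E /= ->.
apply: (@le_integrable _ _ _ _ _ mI _ _ _ _ (integrable_bound mI)).
  by apply/measurable_EFinP; apply: measurable_funTS; exact: measurable_cut_sym_kern.
move=> r /=; rewrite in_itv /= => /andP[ar _].
rewrite lee_fin; apply: le_trans (ler_norm _); apply: integral_cut_bound.
exact: lt_le_trans ar.
Qed.

End at_point.

End kernel.

(** * Principal value and the limit in eps *)

Section tame.
Context (R : realType).

(* What the principal value needs of [Re] and [Im] of the inverse Fourier
   transform; the decay is only asked between points of equal norm. *)
Definition tame m (G : 'rV[R]_m -> R) : Prop :=
  [/\ measurable_fun setT G,
      forall k, exists C, forall zeta zeta', dotv zeta zeta = dotv zeta' zeta' ->
        dotv zeta zeta ^+ k * `|G zeta - G zeta'| <=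
        C * \sum_i `|zeta 0 i - zeta' 0 i| &
      exists B, forall zeta, `|G zeta| <= B].

Lemma lipschitz_continuous_rV m (G : 'rV[R]_m -> R) (C : R) :
  (forall z z', `|G z - G z'| <= C * \sum_i `|z 0 i - z' 0 i|) -> continuous G.
Proof.
move=> GC x U /= /nbhs_ballP[e /= e0 eU].
(* The factor [m] compares the coordinate sum with the maximum norm; the added 1 keeps the
   denominator positive when the product vanishes. *)
pose d := e / (`|C| * m%:R + 1).
have D0 : 0 < `|C| * m%:R + 1 by rewrite ltr_pwDr// mulr_ge0.
have d0 : 0 < d by rewrite divr_gt0.
apply/nbhs_ballP; exists d => //= y [_ xy] /=.
apply: eU; rewrite -ball_normE /=; apply: le_lt_trans (GC x y) _.
apply: (@le_lt_trans _ _ (`|C| * (m%:R * d))).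
  apply: le_trans (ler_wpM2r _ (ler_norm C)) _; first exact: sumr_ge0.
  rewrite ler_wpM2l// mulr_natl -[X in _ *+ X]card_ord -sumr_const.
  by apply: ler_sum => i _; apply: ltW; exact: xy.
by rewrite mulrA mulrA ltr_pdivrMr// mulrC ltr_pM2l// ltrDl.
Qed.

Lemma tame_cosint m a (psi : 'rV[R]_m -> R) :
  schwartz_real psi -> tame (cosint a psi).
Proof.
move=> spsi; split; [|by move=> k; exact: cosint_decay|exact: cosint_bounded].
apply: continuous_measurable_fun_rV.
by have [C /lipschitz_continuous_rV] := cosint_lipschitz a spsi.
Qed.

Lemma tame_scale m c (G : 'rV[R]_m -> R) : tame G -> tame (fun z => c * G z).
Proof.
move=> [mG dG [B bG]]; split; first exact: measurable_funM.
  move=> k; have [C CP] := dG k; exists (`|c| * C) => z z' zz.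
  by rewrite -mulrBr normrM mulrCA -mulrA ler_wpM2l//; exact: CP.
by exists (`|c| * B) => z; rewrite normrM ler_wpM2l.
Qed.

Lemma tame_add m (G H : 'rV[R]_m -> R) :
  tame G -> tame H -> tame (fun z => G z + H z).
Proof.
move=> [mG dG [B bG]] [mH dH [B' bH]]; split; first exact: measurable_funD.
  move=> k; have [C CP] := dG k; have [C' CP'] := dH k.
  exists (C + C') => z z' zz; rewrite mulrDl opprD addrACA.
  apply: le_trans (lerD (CP z z' zz) (CP' z z' zz)).
  rewrite -mulrDr ler_wpM2l ?ler_normD// exprn_ge0//.
  by apply: sumr_ge0 => i _; rewrite -expr2 sqr_ge0.
exists (B + B') => z; apply: le_trans (ler_normD _ _) _; exact: lerD.
Qed.

(** The sine is the cosine with phase -pi/2, so both parts of the complex exponential are covered by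
    [cosint]. *)
Lemma inverse_fourier_Re m (phi : 'rV[R]_m -> Cplx R) zeta : schwartz phi ->
  complex.Re (inverse_fourier phi zeta) =
  (2 * pi) ^- m * (cosint 0 (fun z => complex.Re (phi z)) zeta +
    (-1) * cosint (- (pi / 2)) (fun z => complex.Im (phi z)) zeta).
Proof.
move=> [sr si]; rewrite /inverse_fourier /= mul0r subr0; congr (_ * _).
rewrite mulN1r /cosint -RintegralB//; [|exact: integrable_cosint..].
apply: eq_Rintegral => z _; rewrite addr0 cosBpihalf.
by case: (phi z).
Qed.

Lemma inverse_fourier_Im m (phi : 'rV[R]_m -> Cplx R) zeta : schwartz phi ->
  complex.Im (inverse_fourier phi zeta) =
  (2 * pi) ^- m * (cosint 0 (fun z => complex.Im (phi z)) zeta +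
    cosint (- (pi / 2)) (fun z => complex.Re (phi z)) zeta).
Proof.
move=> [sr si]; rewrite /inverse_fourier /= mul0r addr0; congr (_ * _).
rewrite /cosint -RintegralD//; [|exact: integrable_cosint..].
apply: eq_Rintegral => z _; rewrite addr0 cosBpihalf.
by case: (phi z).
Qed.

Lemma tame_inverse_fourier m (phi : 'rV[R]_m -> Cplx R) : schwartz phi ->
  tame (fun z => complex.Re (inverse_fourier phi z)) /\
  tame (fun z => complex.Im (inverse_fourier phi z)).
Proof.
move=> sphi; have [sr si] := sphi; split.
  under eq_fun do rewrite inverse_fourier_Re//.
  by apply/tame_scale/tame_add; last apply: tame_scale; exact: tame_cosint.
under eq_fun do rewrite inverse_fourier_Im//.
by apply/tame_scale/tame_add; exact: tame_cosint.
Qed.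

End tame.

Lemma Re_scale (R : realType) (q r : R) (w : Cplx R) :
  complex.Re (q%:C * w * r%:C)%C = q * complex.Re w * r.
Proof. by case: w => u v /=; rewrite !mul0r !mulr0 !subr0. Qed.

Lemma Im_scale (R : realType) (q r : R) (w : Cplx R) :
  complex.Im (q%:C * w * r%:C)%C = q * complex.Im w * r.
Proof. by case: w => u v /=; rewrite !mul0r !mulr0 addr0 add0r. Qed.

Section principal_value_I2.
Context (R : realType) (n : nat) (phi : 'rV[R]_(n + n) -> Cplx R).
Hypothesis sphi : schwartz phi.
Notation leb := (@lebesgue_measure R).
Let FR z := complex.Re (inverse_fourier phi z).
Let FI z := complex.Im (inverse_fourier phi z).

Lemma pv_polar_Re omega nu r t :
  complex.Re (pv_polar (I2_integrand phi omega nu) r t) =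
  kern FR (omega, nu) r t.
Proof.
exact: Re_scale.
Qed.

Lemma pv_polar_Im omega nu r t :
  complex.Im (pv_polar (I2_integrand phi omega nu) r t) =
  kern FI (omega, nu) r t.
Proof.
exact: Im_scale.
Qed.

Lemma Cintegral_pv_sector omega nu a r :
  Cintegral leb (pv_sector a) (pv_polar (I2_integrand phi omega nu) r) =
  ((\int[leb]_(t in pv_sector a) kern FR (omega, nu) r t) +i*
   (\int[leb]_(t in pv_sector a) kern FI (omega, nu) r t))%C.
Proof.
rewrite /Cintegral; congr (_ +i* _)%C; apply: eq_Rintegral => t _.
  exact: pv_polar_Re.
exact: pv_polar_Im.
Qed.

Lemma pv_truncatedE omega nu a :
  pv_truncated (I2_integrand phi omega nu) a =
  ((\int[leb]_(r in `[a^-1, a])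
      \int[leb]_(t in pv_sector a) kern FR (omega, nu) r t) +i*
   (\int[leb]_(r in `[a^-1, a])
      \int[leb]_(t in pv_sector a) kern FI (omega, nu) r t))%C.
Proof.
rewrite /pv_truncated; transitivity (Cintegral leb `[a^-1, a]%classic (fun r =>
    ((\int[leb]_(t in pv_sector a) kern FR (omega, nu) r t) +i*
     (\int[leb]_(t in pv_sector a) kern FI (omega, nu) r t))%C)); last by [].
congr (Cintegral _ _ _); apply/funext => r; exact: Cintegral_pv_sector.
Qed.

Lemma cvg_pv_truncated omega nu : sphere R n omega -> sphere R n nu ->
  pv_truncated (I2_integrand phi omega nu) a @[a --> +oo] -->
  ((pv_kern FR (omega, nu) +i* pv_kern FI (omega, nu))%C : Cplx R).
Proof.
move=> so sn; have [[mR dR bR] [mI dI bI]] := tame_inverse_fourier sphi.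
have [KR KRP] := sym_kern_bound dR.
have [KI KIP] := sym_kern_bound dI.
apply: cvg_Cplx; under eq_fun do rewrite pv_truncatedE /=.
  by apply: (cvg_pv_truncated_kern mR bR (K := KR)) => r t; exact: KRP.
by apply: (cvg_pv_truncated_kern mI bI (K := KI)) => r t; exact: KIP.
Qed.

Lemma pvE omega nu : sphere R n omega -> sphere R n nu ->
  pv (I2_integrand phi omega nu) =
  (pv_kern FR (omega, nu) +i* pv_kern FI (omega, nu))%C.
Proof.
move=> so sn; apply: cvg_lim; last exact: cvg_pv_truncated.
exact: norm_hausdorff.
Qed.

Lemma pv_exists_I2 omega nu : sphere R n omega -> sphere R n nu ->
  pv_exists (I2_integrand phi omega nu).
Proof.
move=> so sn; have [[mR dR bR] [mI dI bI]] := tame_inverse_fourier sphi.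
have [KR KRP] := sym_kern_bound dR.
have [KI KIP] := sym_kern_bound dI.
split; last by apply: cvgP; exact: cvg_pv_truncated.
near=> a; have a4 : 4 <= a by near: a; exact: (nbhs_pinfty_ge (num_real _)).
have a0 : 0 < a by apply: lt_le_trans a4.
split=> [r|].
  rewrite in_itv /= => /andP[ar _].
  have r0 : 0 < r by apply: lt_le_trans ar; rewrite invr_gt0.
  split; under eq_fun do rewrite ?pv_polar_Re ?pv_polar_Im.
    exact: (integrable_kern_sector mR bR).
  exact: (integrable_kern_sector mI bI).
have mI' : measurable (`[a^-1, a]%classic : set (measurableTypeR R)).
  exact: measurable_itv.
split.
  apply: (@eq_integrable _ _ _ leb _ mI' (EFin \o (fun r =>
    \int[leb]_(t in pv_sector a) kern FR (omega, nu) r t))).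
    by move=> r _; rewrite -[RHS]/((complex.Re (Cintegral leb (pv_sector a)
      (pv_polar (I2_integrand phi omega nu) r)))%:E) Cintegral_pv_sector.
  by apply: (integrable_Rintegral_sector mR bR (K := KR)) => // r t; exact: KRP.
apply: (@eq_integrable _ _ _ leb _ mI' (EFin \o (fun r =>
  \int[leb]_(t in pv_sector a) kern FI (omega, nu) r t))).
  by move=> r _; rewrite -[RHS]/((complex.Im (Cintegral leb (pv_sector a)
    (pv_polar (I2_integrand phi omega nu) r)))%:E) Cintegral_pv_sector.
by apply: (integrable_Rintegral_sector mI bI (K := KI)) => // r t; exact: KIP.
Unshelve. all: by end_near.
Qed.

End principal_value_I2.

(** * Dominated convergence over pairs of directions *)

Section I2_limit.
Context (R : realType) (n : nat).
Notation V := ('rV[R]_n * 'rV[R]_n)%type.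
Notation sigma2 := (surface_measure R n \x surface_measure R n)%E.

Definition sphere2 : set V := [set p | sphere R n p.1 /\ sphere R n p.2].

Definition skew (eps : R) : set V := [set p | eps <= `|dotv p.1 p.2|].

Lemma I2_regionE eps : @I2_region R n eps = sphere2 `&` skew eps.
Proof. by apply/seteqP; split => p; [move=> []|move=> [[]]]. Qed.

Lemma measurable_sphere2 : measurable sphere2.
Proof.
have ms : measurable (sphere R n).
  rewrite (_ : sphere R n = @enorm R n @^-1` [set 1]).
    rewrite -[X in measurable X]setTI.
    exact: (@measurable_enorm R n measurableT _ (measurable_set1 _)).
  by apply/seteqP; split.
rewrite (_ : sphere2 = sphere R n `*` sphere R n); first exact: measurableX.
by apply/seteqP; split.
Qed.

Lemma measurable_skew eps : measurable (skew eps).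
Proof.
have md : measurable_fun setT (fun p : V => `|dotv p.1 p.2|).
  apply: measurableT_comp => //; apply: measurable_sum => i.
  apply: measurable_funM; apply: (measurableT_comp (measurable_coord i)).
    exact: measurable_fst.
  exact: measurable_snd.
rewrite (_ : skew eps = (fun p : V => `|dotv p.1 p.2|) @^-1` `[eps, +oo[).
  by rewrite -[X in measurable X]setTI; exact: md.
by apply/seteqP; split => p /=; rewrite in_itv /= andbT.
Qed.

(** The product surface measure is finite on the whole ambient space, so a bound on the spheres is
    enough. *)
Lemma integrable_sphere2 (D : set V) (f : V -> R) (B : R) :
  measurable D -> D `<=` sphere2 -> measurable_fun setT f ->
  (forall p, sphere2 p -> `|f p| <= B) -> sigma2.-integrable D (EFin \o f).
Proof.
move=> mD Ds mf fB; apply: measurable_bounded_integrable => //.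
- apply: (@le_lt_trans _ _ (sigma2 setT)).
    by apply: le_measure; rewrite ?inE.
  rewrite -setXTT product_measure1E// lte_mul_pinfty//.
    exact: fin_num_measure.
  by rewrite -ge0_fin_numE//; exact: fin_num_measure.
- exact: measurable_funTS.
- exists B; split; first exact: num_real.
  by move=> x Bx p Dp; apply: le_trans (ltW Bx); exact/fB/Ds.
Qed.

(** As eps decreases to 0 the regions exhaust the pairs with nonzero inner product. The limit
    integrand keeps the indicator of these pairs, so the measure of the orthogonal pairs never has
    to be computed. *)
Lemma cvg_Rintegral_skew (f : V -> R) (B : R) :
  measurable_fun setT f -> (forall p, sphere2 p -> `|f p| <= B) ->
  cvg (\int[sigma2]_(p in sphere2 `&` skew eps) f p @[eps --> 0^'+]).
Proof.
move=> mf fB; under eq_fun do rewrite Rintegral_setI_indic.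
have m0 : measurable [set p : V | dotv p.1 p.2 != 0].
  rewrite (_ : [set p | _] = \bigcup_(k : nat) skew k.+1%:R^-1).
    by apply: bigcupT_measurable => k; exact: measurable_skew.
  apply/seteqP; split => [p /= d0|p [k _]].
    have /ltr_add_invr[k] : 0 < `|dotv p.1 p.2| by rewrite normr_gt0.
    by rewrite add0r => /ltW; exists k.
  rewrite /skew /= => kd; rewrite -normr_gt0.
  by apply: lt_le_trans kd; rewrite invr_gt0.
apply: cvgP; apply: (dominated_cvg_at_right
  (g := fun p => f p * \1_[set p : V | dotv p.1 p.2 != 0] p)
  (h := fun=> B) measurable_sphere2).
- by apply: measurable_funTS; apply: measurable_funM.
- exact: (@integrable_sphere2 sphere2 (fun=> B) `|B| measurable_sphere2
    (@subset_refl _ _) (measurable_cst _) (fun _ _ => lexx _)).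
- move=> eps; apply: measurable_funTS; apply: measurable_funM => //.
  exact: measurable_indic (measurable_skew eps).
- move=> eps p sp; apply: le_trans (fB p sp).
  by rewrite normrM ler_piMr// indicE; case: (_ \in _); rewrite ?normr1 ?normr0.
- move=> p sp; apply: cvg_near_cst; have [d0|d0] := eqVneq (dotv p.1 p.2) 0.
    near=> eps; rewrite !indicE.
    have e0 : 0 < eps by near: eps; exact: nbhs_right_gt.
    rewrite !memNset//; last by rewrite /skew /= d0 normr0; apply/negP; rewrite -ltNge.
    by rewrite /= d0 eqxx.
  rewrite -normr_gt0 in d0.
  near=> eps; rewrite !indicE !mem_set//= -?normr_gt0// /skew /=.
  by near: eps; exact: nbhs_right_le.
Unshelve. all: by end_near.
Qed.

End I2_limit.

(** [pv] and [Cintegral] are total, so existence cannot be read off from them: convergence of every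
    principal value and integrability over every region are asserted beside the limit. *)
Theorem theorem4p2 (R : realType) (n : nat) (n_gt0 : (0 < n)%N)
    (phi : 'rV[R]_(n + n) -> Cplx R) (phi_schwartz : schwartz phi) :
  (forall eps : R, 0 < eps ->
     (forall omega nu : 'rV[R]_n, I2_region eps (omega, nu) ->
        pv_exists (I2_integrand phi omega nu)) /\
     Cintegrable (surface_measure R n \x surface_measure R n)%E
       (I2_region eps) (fun p => pv (I2_integrand phi p.1 p.2))) /\
  cvg (I2_truncated phi eps @[eps --> 0^'+]).
Proof.
have [[mR dR _] [mI dI _]] := tame_inverse_fourier phi_schwartz.
set FR := fun z => _ in mR dR; set FI := fun z => _ in mI dI.
pose PR := pv_kern FR : 'rV[R]_n * 'rV[R]_n -> R.
pose PI := pv_kern FI : 'rV[R]_n * 'rV[R]_n -> R.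
have mPR : measurable_fun setT PR by exact: measurable_pv_kern.
have mPI : measurable_fun setT PI by exact: measurable_pv_kern.
have bound (F : 'rV[R]_(n + n) -> R) : (forall k, exists C, forall zeta zeta',
    dotv zeta zeta = dotv zeta' zeta' ->
    dotv zeta zeta ^+ k * `|F zeta - F zeta'| <=
    C * \sum_i `|zeta 0 i - zeta' 0 i|) -> measurable_fun setT F ->
    exists B, forall p, @sphere2 R n p -> `|pv_kern F p| <= B.
  move=> dF mF; have [K KP] := sym_kern_bound dF.
  eexists => p [p1 p2]; apply: (pv_kern_bound mF (K := K)) => r t.
  exact: KP.
have [BR BRP] := bound _ dR mR; have [BI BIP] := bound _ dI mI.
(* Off the spheres nothing is known about [pv]; there it is not compared with [PR] and [PI], which
   are measurable on the whole space and replace it on the regions. *)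
have pvP p : @sphere2 R n p ->
    pv (I2_integrand phi p.1 p.2) = (PR p +i* PI p)%C.
  by case: p => p1 p2 [s1 s2]; exact: pvE.
have mreg eps : measurable (@I2_region R n eps).
  rewrite I2_regionE; apply: measurableI; first exact: measurable_sphere2.
  exact: measurable_skew.
have regS eps : @I2_region R n eps `<=` @sphere2 R n.
  by rewrite I2_regionE => p [].
split=> [eps _|].
  split=> [omega nu [/= so sn _]|]; first exact: pv_exists_I2.
  split.
    apply: (@eq_integrable _ _ _ _ _ (mreg eps) (EFin \o PR)).
      by move=> p; rewrite inE => /regS /pvP /= ->.
    exact: (integrable_sphere2 (mreg eps) (@regS eps) mPR BRP).
  apply: (@eq_integrable _ _ _ _ _ (mreg eps) (EFin \o PI)).
    by move=> p; rewrite inE => /regS /pvP /= ->.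
  exact: (integrable_sphere2 (mreg eps) (@regS eps) mPI BIP).
have cR := cvg_Rintegral_skew mPR BRP; have cI := cvg_Rintegral_skew mPI BIP.
apply: cvgP; apply: cvg_Cplx.
  apply: cvg_trans cR; apply: near_eq_cvg; near=> eps.
  rewrite /I2_truncated /= -I2_regionE; apply: eq_Rintegral => p.
  by rewrite inE => /regS /pvP ->.
apply: cvg_trans cI; apply: near_eq_cvg; near=> eps.
rewrite /I2_truncated /= -I2_regionE; apply: eq_Rintegral => p.
by rewrite inE => /regS /pvP ->.
Unshelve. all: by end_near.
Qed.
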